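(* Let $s\in\mathbb{N}$, $p,q\in[1,\infty]$, let $p^*$ be the conjugate of $p$ ($1/p+1/p^*=1$), let $\boldsymbol{\gamma}=(\gamma_{\mathfrak{u}})_{\mathfrak{u}\subseteq[s]}$ be non-negative weights, and let $\varepsilon>0$. The $\varepsilon$-truncation dimension of the approximation problem for the weighted anchored space $F_{s,p,\boldsymbol{\gamma}}$ satisfies \[ \mathrm{dim}^{\mathrm{trnc}}(\varepsilon)\,\le\,\min\left\{k\,:\,\left(\sum_{\mathfrak{u}\not\subseteq[k]}\frac{\gamma_{\mathfrak{u}}^{p^*}}{(\frac{q}{p^*}+1)^{p^*|\mathfrak{u}|/q}}\right)^{1/p^*}\le\varepsilon\right\}\quad\text{for } p>1, \] and \[ \mathrm{dim}^{\mathrm{trnc}}(\varepsilon)\,=\,\min\left\{k\,:\,\max_{\mathfrak{u}\not\subseteq[k]}\gamma_{\mathfrak{u}}\le\varepsilon\right\}\quad\text{for } p=1. \] Here $k$ ranges over the non-negative integers, and the sum and the maximum are over all $\mathfrak{u}\subseteq[s]$ with $\mathfrak{u}\not\subseteq[k]$ (an empty sum or maximum is $0$).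
   Context: Notation: $[s]=\{1,\dots,s\}$, $[0]=\emptyset$; $\mathfrak{u},\mathfrak{v}$ denote subsets of $[s]$. For $\boldsymbol{x}\in[0,1]^s$, $[\boldsymbol{x}_{\mathfrak{u}};\boldsymbol{0}_{-\mathfrak{u}}]$ is the vector obtained from $\boldsymbol{x}$ by replacing $x_j$ by $0$ for all $j\notin\mathfrak{u}$. $f^{(\mathfrak{u})}=\prod_{j\in\mathfrak{u}}\frac{\partial}{\partial x_j}f$, $f^{(\emptyset)}=f$. For $q=\infty$ the number $(\frac{q}{p^*}+1)^{1/q}$ is read as its limiting value $1$. Spaces: Let $F$ be the space of absolutely continuous functions on $[0,1]$ vanishing at $0$ with derivative in $L_p([0,1])$, with norm $\|f\|_F=\|f'\|_{L_p}$. For nonempty $\mathfrak{u}\subseteq[s]$, $F_{\mathfrak{u}}$ is the completion of the span of the functions $f(\boldsymbol{x})=\prod_{j\in\mathfrak{u}}f_j(x_j)$, $f_j\in F$, on $[0,1]^s$ under the norm $\|f\|_{F_{\mathfrak{u}}}=\|f^{(\mathfrak{u})}\|_{L_p([0,1]^{|\mathfrak{u}|})}$. (Its elements are functions depending only on $x_j$, $j\in\mathfrak{u}$, vanishing if $x_j=0$ for some $j\in\mathfrak{u}$, of the form $f(\boldsymbol{x})=\int_{\prod_{j\in\mathfrak{u}}[0,x_j)}g(\boldsymbol{t})\,d\boldsymbol{t}$ with $g=f^{(\mathfrak{u})}\in L_p([0,1]^{|\mathfrak{u}|})$.) $F_\emptyset$ is the space of constant functions with norm $|\cdot|$. Let $\mathfrak{U}=\{\mathfrak{u}\subseteq[s]:\gamma_{\mathfrak{u}}>0\}$.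 The weighted anchored space is $F_{s,p,\boldsymbol{\gamma}}=\mathrm{span}\big(\bigcup_{\mathfrak{u}\in\mathfrak{U}}F_{\mathfrak{u}}\big)$ with norm $\|f\|_{F_{s,p,\boldsymbol{\gamma}}}=\big(\sum_{\mathfrak{u}\in\mathfrak{U}}\gamma_{\mathfrak{u}}^{-p}\|f^{(\mathfrak{u})}([\cdot_{\mathfrak{u}};\boldsymbol{0}_{-\mathfrak{u}}])\|_{L_p}^p\big)^{1/p}$ for $p<\infty$, and $\max_{\mathfrak{u}\in\mathfrak{U}}\gamma_{\mathfrak{u}}^{-1}\|f^{(\mathfrak{u})}([\cdot_{\mathfrak{u}};\boldsymbol{0}_{-\mathfrak{u}}])\|_{L_\infty}$ for $p=\infty$. Every $f\in F_{s,p,\boldsymbol{\gamma}}$ has a unique anchored decomposition $f=\sum_{\mathfrak{u}\in\mathfrak{U}}f_{\mathfrak{u}}$ with $f_{\mathfrak{u}}\in F_{\mathfrak{u}}$, and $f^{(\mathfrak{u})}([\cdot_{\mathfrak{u}};\boldsymbol{0}_{-\mathfrak{u}}])=f_{\mathfrak{u}}^{(\mathfrak{u})}$. $\mathcal{L}_q$ is a fixed normed linear space containing $F_{s,p,\boldsymbol{\gamma}}$ as a subspace and such that $\|f_{\mathfrak{u}}\|_{\mathcal{L}_q}=\|f_{\mathfrak{u}}\|_{L_q([0,1]^{|\mathfrak{u}|})}$ for all $f_{\mathfrak{u}}\in F_{\mathfrak{u}}$, $\mathfrak{u}\in\mathfrak{U}$. Truncation dimension: $\mathrm{dim}^{\mathrm{trnc}}(\varepsilon)$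 is the smallest non-negative integer $k$ such that $\big\|\sum_{\mathfrak{u}\not\subseteq[k]}f_{\mathfrak{u}}\big\|_{\mathcal{L}_q}\le\varepsilon\,\big\|\sum_{\mathfrak{u}\not\subseteq[k]}f_{\mathfrak{u}}\big\|_{F_{s,p,\boldsymbol{\gamma}}}$ for all $f=\sum_{\mathfrak{u}\in\mathfrak{U}}f_{\mathfrak{u}}\in F_{s,p,\boldsymbol{\gamma}}$ (sums over $\mathfrak{u}\in\mathfrak{U}$ with $\mathfrak{u}\not\subseteq[k]$). *)

(* Defs.v *)
From HB Require Import structures.
From mathcomp Require Import all_boot all_order all_algebra.
From mathcomp Require Import all_classical all_reals all_analysis.

Set Implicit Arguments.
Unset Strict Implicit.
Unset Printing Implicit Defensive.

Import Order.TTheory GRing.Theory Num.Theory.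
Import numFieldNormedType.Exports.

Local Open Scope classical_set_scope.
Local Open Scope ring_scope.

Section unit_interval.
Variable R : realType.

Definition unit_interval_measure : set (measurableTypeR R) -> \bar R :=
  mrestr lebesgue_measure (measurable_itv `[0%R, 1%R]).

HB.instance Definition _ := Measure.on unit_interval_measure.

Let unit_interval_measure_setT : unit_interval_measure setT = 1%E.
Proof.
by rewrite /unit_interval_measure /mrestr setTI lebesgue_measure_itv /=
  lte_fin ltr01 -EFinB subr0.
Qed.

HB.instance Definition _ :=
  Measure_isProbability.Build _ _ _ unit_interval_measure
    unit_interval_measure_setT.

End unit_interval.
Arguments unit_interval_measure {R}.

Section cube_measure.
Variable R : realType.

Definition tuple_cons (n : nat) (z : measurableTypeR R * n.-tuple (measurableTypeR R)) :
  n.+1.-tuple (measurableTypeR R) := [tuple of z.1 :: z.2].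

Lemma measurable_tuple_cons (n : nat) : measurable_fun setT (@tuple_cons n).
Proof. exact: measurable_cons. Qed.

HB.instance Definition _ (n : nat) :=
  isMeasurableFun.Build _ _ _ _ (@tuple_cons n) (@measurable_tuple_cons n).

(* The measure lives on R^n and is carried by [0,1]^n; for n = 0 it is the
   unit mass on the one-point space. *)
Fixpoint cube_measure (n : nat) : probability (n.-tuple (measurableTypeR R)) R :=
  match n with
  | 0 => dirac [tuple]
  | m.+1 => distribution (unit_interval_measure \x cube_measure m)%E (@tuple_cons m)
  end.

End cube_measure.
Arguments cube_measure {R} n.

(* The coordinate with number j in {1,...,s} is the ordinal j-1 of 'I_s. *)

Section points.
Variables (R : realType) (s : nat).
Implicit Types (u : {set 'I_s}) (x : s.-tuple R).

Definition unit_cube (n : nat) : set (n.-tuple R) :=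
  [set x | forall i, 0 <= tnth x i <= 1].

(* {1,...,k}, intersected with {1,...,s} *)
Definition first_coords (k : nat) : {set 'I_s} := [set j : 'I_s | (j < k)%N].

(* [x_u; 0_{-u}] *)
Definition anchor u x : s.-tuple R :=
  [tuple if j \in u then tnth x j else 0 | j < s].

(* x_u, listed in the order of enum_val on u *)
Definition restr u x : #|u|.-tuple R := [tuple tnth x (enum_val i) | i < #|u|].

(* [y_u; 0_{-u}] for a vector y indexed by u: the sum has one term if j \in u
   and none otherwise. *)
Definition embed u (y : #|u|.-tuple R) : s.-tuple R :=
  [tuple \sum_(i < #|u| | enum_val i == j) tnth y i | j < s].

Definition anchored_box (n : nat) (y : n.-tuple R) : set (n.-tuple R) :=
  [set t | forall i, 0 <= tnth t i < tnth y i].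

End points.
Arguments unit_cube {R} n.
Arguments first_coords {s} k.

(* A function on [0,1]^s is represented by its extension by 0 to R^s. *)

Section spaces.
Variables (R : realType) (s : nat).
Implicit Types (p q : \bar R) (u v : {set 'I_s}) (gamma : {set 'I_s} -> R)
  (f h : s.-tuple R -> R) (c : {set 'I_s} -> s.-tuple R -> R).

Definition abs_cont01 (f : R -> R) : Prop :=
  forall e, 0 < e -> exists2 d, 0 < d &
    forall (n : nat) (a b : 'I_n -> R),
      (forall i, [/\ 0 <= a i, a i <= b i & b i <= 1]) ->
      (forall i j, i != j -> b i <= a j \/ b j <= a i) ->
      \sum_(i < n) (b i - a i) < d ->
      \sum_(i < n) `|f (b i) - f (a i)| < e.

(* f belongs to the univariate space F and f' = df in L_p([0,1]) *)
Definition in_F p (f df : R -> R) : Prop :=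
  [/\ abs_cont01 f, f 0 = 0, df \in Lfun unit_interval_measure p &
      {ae unit_interval_measure,
        forall t, is_derive (t : R^o) 1 (f : R^o -> R^o) (df t)}].

(* h is in the span of the tensor products over u of elements of F, and
   dh = h^(u); for u = set0 the products are empty and h is a constant. *)
Definition in_tensor_span p u h (dh : #|u|.-tuple R -> R) : Prop :=
  exists (m : nat) (a : 'I_m -> R) (f df : 'I_m -> 'I_#|u| -> R -> R),
    [/\ forall i j, in_F p (f i j) (df i j),
        h = (fun x => \sum_(i < m) a i *
              \prod_(j < #|u|) f i j (tnth (restr u x) j)) \_ (unit_cube s) &
        dh = (fun y => \sum_(i < m) a i *
              \prod_(j < #|u|) df i j (tnth y j))].

Arguments in_tensor_span p u h dh : clear implicits.

(* The completion F_u, realised as a space of functions: g = f^(u) is an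
   L_p-limit of derivatives h^(u) of elements h of the span, and f is recovered
   from g by integration. For p = +oo such g form a proper closed subspace of
   L_oo as soon as #|u| > 1. As cube_measure 0 is a unit mass, F_set0 consists
   of the constants, with norm the absolute value. *)
Definition F_ p u : set (s.-tuple R -> R) :=
  [set f | exists g : #|u|.-tuple R -> R,
    [/\ g \in Lfun (cube_measure #|u|) p,
        forall e : R, 0 < e -> exists h, exists2 dh, in_tensor_span p u h dh &
          ('N[cube_measure #|u|]_p[EFin \o (g \- dh)%R] < e%:E)%E &
        f = (fun x => \int[cube_measure #|u|]_(t in anchored_box (restr u x)) g t)
              \_ (unit_cube s)]].

Definition anchored_decomposition p gamma f c : Prop :=
  (forall u, 0 < gamma u -> F_ p u (c u)) /\
  f = (fun x => \sum_(u | 0 < gamma u) c u x).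

Definition anchored_space p gamma : set (s.-tuple R -> R) :=
  [set f | exists c, anchored_decomposition p gamma f c].

(* The mixed derivative f^(u)([._u; 0_{-u}]) exists only almost everywhere; it
   is the density (unique up to null sets) of the mixed increments of f:
   iterating the fundamental theorem of calculus over the coordinates in u,
     \int_[0,x_u) f^(u)([t_u; 0_{-u}]) dt
       = \sum_(v \subset u) (-1)^(|u| - |v|) f([x_v; 0_{-v}]).
   If f vanishes whenever x_j = 0 for some j \in u, only v = u contributes. *)
Definition is_mixed_derivative f u (g : #|u|.-tuple R -> R) : Prop :=
  g \in Lfun (cube_measure #|u|) 1%E /\
  forall x, unit_cube s x ->
    \sum_(v : {set 'I_s} | v \subset u) (-1) ^+ #|u :\: v| * f (anchor v x)
    = \int[cube_measure #|u|]_(t in anchored_box (restr u x)) g t.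

Arguments is_mixed_derivative f u g : clear implicits.

Definition mixed_derivative f u : #|u|.-tuple R -> R :=
  xget (fun=> 0) [set g | is_mixed_derivative f u g].

Arguments mixed_derivative f u : clear implicits.

Definition anchored_norm p gamma f : \bar R :=
  let N u := 'N[cube_measure #|u|]_p[EFin \o mixed_derivative f u]%E in
  match p with
  | r%:E => ((\sum_(u | (0 < gamma u)%R) (gamma u `^ (- r))%R%:E * N u `^ r)
              `^ r^-1)%E
  | _ => (\big[maxe/0]_(u | (0 < gamma u)%R) ((gamma u)^-1%R%:E * N u))%E
  end.

(* L with the injection inj is a normed space containing the anchored space
   as a linear subspace and extending the L_q-norm of each F_u. *)
Definition contains_anchored_space p q gamma (L : normedModType R)
    (inj : (s.-tuple R -> R) -> L) : Prop :=
  [/\ forall (a : R) f h, anchored_space p gamma f -> anchored_space p gamma h ->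
        inj (fun x => a * f x + h x) = a *: inj f + inj h,
      forall f h, anchored_space p gamma f -> anchored_space p gamma h ->
        inj f = inj h -> f = h &
      forall u f, 0 < gamma u -> F_ p u f ->
        `|inj f|%:E =
        'N[cube_measure #|u|]_q[EFin \o (fun y => f (embed y))]%E].

End spaces.
Arguments in_tensor_span {R s} p u h dh.
Arguments is_mixed_derivative {R s} f u g.
Arguments mixed_derivative {R s} f u.

(* 0 if P is empty *)
Definition least (P : set nat) : nat :=
  xget 0%N [set k | P k /\ forall m, P m -> (k <= m)%N].

Lemma leastP (P : set nat) : P !=set0 ->
  P (least P) /\ forall m, P m -> (least P <= m)%N.
Proof.
move=> [k Pk]; apply: (@xgetPex _ _ [set k | P k /\ forall m, P m -> (k <= m)%N]).
have exP : exists n, `[< P n >] by exists k; apply/asboolP.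
exists (ex_minn exP); case: ex_minnP => m /asboolP Pm m_min.
by split=> // n Pn; apply/m_min/asboolP.
Qed.

Section truncation.
Variables (R : realType) (s : nat).
Implicit Types (p q : \bar R) (gamma : {set 'I_s} -> R).

Definition truncation_tail gamma (c : {set 'I_s} -> s.-tuple R -> R) (k : nat)
    : s.-tuple R -> R :=
  fun x => \sum_(u : {set 'I_s} | (0 < gamma u) && ~~ (u \subset first_coords k))
    c u x.

Definition truncation_dim p gamma (L : normedModType R)
    (inj : (s.-tuple R -> R) -> L) (eps : R) : nat :=
  least [set k | forall f c, anchored_decomposition p gamma f c ->
    (`|inj (truncation_tail gamma c k)|%:E
     <= eps%:E * anchored_norm p gamma (truncation_tail gamma c k))%E].

(* (q / r + 1) ^ (r n / q), with its limiting value 1 for q = +oo *)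
Definition anchored_const q (r : R) (n : nat) : R :=
  match q with
  | t%:E => (t / r + 1) `^ (r * n%:R / t)
  | _ => 1
  end.

(* Only meaningful for p > 1, when the conjugate exponent is finite. *)
Definition truncation_bound p q gamma (k : nat) : R :=
  let r := fine (hoelder_conjugate p) in
  (\sum_(u : {set 'I_s} | ~~ (u \subset first_coords k))
     gamma u `^ r / anchored_const q r #|u|) `^ r^-1.

End truncation.

(* Main.v *)
Require Import Defs.
From HB Require Import structures.
From mathcomp Require Import all_boot all_order all_algebra.
From mathcomp Require Import all_classical all_reals all_analysis.
From mathcomp Require Import measurable_realfun ess_sup_inf.

(** Write r for the conjugate exponent of p. A function f_u of F_u is the
    integral of its density f_u^(u) over the boxes [0, x_u) (box_primitive), so
    Hoelder's inequality on a box gives, with the L_p norm of the density,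
      |f_u(x)| <= ||f_u^(u)||_p * prod_j x_j^(1 / r)        (normr_box_integral).
    The L_q norm of the product is computed one coordinate at a time from the
    integral of x^(q / r) over [0, 1], that is 1 / (q / r + 1)
    (Lnorm_le_anchored_const). This bounds ||f_u||_q by a constant C_u times
    ||f_u^(u)||_p. Summing over the components of the tail and applying
    Hoelder's inequality to the finite sum of the terms
    (gamma_u C_u) (||f_u^(u)||_p / gamma_u) gives truncation_bound times the
    anchored norm of the tail (tail_norm_le_eps). So every k whose bound is at
    most eps satisfies the inequality that defines the truncation dimension, and
    the smallest such k is at least that dimension. For p = 1 the same reasoning
    with C_u = 1 and a maximum in place of the sum shows that it suffices that
    gamma_u <= eps for all u not contained in [k] (tail_norm_le_eps1).

    For p = 1 this condition is also necessary. Concentrate a density of mass 1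
    on [0, delta)^u. Its primitive has anchored norm 1 / gamma_u and equals 1
    outside a neighbourhood of the faces x_j = 0, so that its L_q norm tends to
    1 as delta tends to 0. The inequality for this function gives gamma_u <= eps
    (weight_le_of_tail_norm_le), so both sides of the equation are minima of the
    same set.

    The anchored norm is expressed by a mixed derivative of the whole function,
    that is by any density of its mixed increments. An alternating sum over the
    subsets of [s] shows that these increments isolate the component f_u
    (increment_sum_box_primitive). The upper bounds use that the derivative is
    a density of f_u. The lower bound needs the norm of a given
    density, hence that a function whose integrals over all anchored boxes
    vanish is zero almost everywhere; this follows from the pi-lambda theorem
    (ae_eq0_of_anchored_boxes). *)

Set Implicit Arguments.
Unset Strict Implicit.
Unset Printing Implicit Defensive.

Import Order.TTheory GRing.Theory Num.Theory.
Import numFieldNormedType.Exports.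
Local Open Scope classical_set_scope.
Local Open Scope ring_scope.

(** * Hoelder's inequality for finite sums *)

Lemma powR_invK (R : realType) (x p : R) : 0 <= x -> p != 0 ->
  (x `^ p^-1) `^ p = x.
Proof. by move=> x0 p0; rewrite -powRrM mulVf// powRr1. Qed.

(** Induction on the sequence: the two-term inequality merges the head with
    the two norms of the tail. *)
Lemma hoelder_sum (R : realType) (I : Type) (s : seq I) (P : pred I)
    (a b : I -> R) (p q : R) :
  (forall i, 0 <= a i) -> (forall i, 0 <= b i) ->
  0 < p -> 0 < q -> p^-1 + q^-1 = 1 ->
  \sum_(i <- s | P i) a i * b i <=
  (\sum_(i <- s | P i) a i `^ p) `^ p^-1 *
  (\sum_(i <- s | P i) b i `^ q) `^ q^-1.
Proof.
move=> a0 b0 p0 q0 pq.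
have sum_ge0 (c : I -> R) (e : R) t : 0 <= \sum_(i <- t | P i) c i `^ e.
  by apply: sumr_ge0 => i _; exact: powR_ge0.
elim: s => [|i s IH].
  by rewrite !big_nil mulr_ge0// powR_ge0.
rewrite !big_cons; case: ifP => // _.
set A := \sum_(j <- s | P j) a j `^ p.
set B := \sum_(j <- s | P j) b j `^ q.
apply: (@le_trans _ _ (a i * b i + A `^ p^-1 * B `^ q^-1)).
  by rewrite lerD2l.
clear IH.
have := sum_ge0 b q s; have := sum_ge0 a p s.
rewrite -/A -/B; move: A B => A B A0 B0.
have := @hoelder2 R (a i) (A `^ p^-1) (b i) (B `^ q^-1) p q
  (a0 i) (powR_ge0 _ _) (b0 i) (powR_ge0 _ _) p0 q0 pq.
by rewrite (powR_invK A0 (lt0r_neq0 p0)) (powR_invK B0 (lt0r_neq0 q0)).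
Qed.

(** * Integration over the cube *)

Section cube_measure_theory.
Variable R : realType.

Lemma integral_unit_interval (f : measurableTypeR R -> R) :
  measurable_fun setT f ->
  (forall x, 0 <= f x) ->
  (\int[unit_interval_measure]_x (f x)%:E =
   \int[lebesgue_measure]_(x in `[0%R, 1%R]) (f x)%:E)%E.
Proof.
move=> mf f0.
have mI : measurable (`[0%R, 1%R] : set (measurableTypeR R)).
  exact: measurable_itv.
have mf' : measurable_fun setT (EFin \o f) by exact/measurable_EFinP.
have If0 : unit_interval_measure (~` (`[0%R, 1%R] : set (measurableTypeR R))) = 0%E.
  by rewrite /unit_interval_measure /mrestr setICl measure0.
rewrite (ge0_negligible_integral (measurableC mI))//; last first.
  by move=> x _; rewrite lee_fin.
rewrite setTD setCK.
apply: eq_measure_integral => A mA AI.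
transitivity (lebesgue_measure (A `&` `[0%R, 1%R])); first by [].
by rewrite setIidl.
Qed.

Lemma measurable_prod_tnth n (phi : 'I_n -> measurableTypeR R -> R) :
  (forall i, measurable_fun setT (phi i)) ->
  measurable_fun [set: n.-tuple (measurableTypeR R)]
    (fun t => \prod_(i < n) phi i (tnth t i)).
Proof.
move=> mphi.
apply: (@measurable_prod _ _ _ _ _ _ (fun i t => phi i (tnth t i))) => i _.
exact: (measurableT_comp (mphi i) (@measurable_tnth _ (measurableTypeR R) n i)).
Qed.

(** Tonelli's theorem, one coordinate at a time. The integrals of the factors
    are given as reals, so that no product of extended reals occurs. *)
Lemma integral_cube_prod n (phi : 'I_n -> measurableTypeR R -> R) (c : 'I_n -> R) :
  (forall i, measurable_fun setT (phi i)) -> (forall i x, 0 <= phi i x) ->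
  (forall i, (\int[unit_interval_measure]_x (phi i x)%:E = (c i)%:E)%E) ->
  (\int[cube_measure n]_t (\prod_(i < n) phi i (tnth t i))%:E =
   (\prod_(i < n) c i)%:E)%E.
Proof.
elim: n phi c => [|n IH] phi c mphi phi0 phic.
  under eq_integral do rewrite big_ord0.
  by rewrite big_ord0 integral_cst//= diracT mule1.
rewrite /=.
rewrite ge0_integral_distribution; last 2 first.
- by apply/measurable_EFinP; exact: measurable_prod_tnth mphi.
- by move=> t; rewrite lee_fin prodr_ge0.
rewrite fubini_tonelli1; last 2 first.
- apply/measurable_EFinP.
  exact: (measurableT_comp (measurable_prod_tnth mphi)
    (@measurable_tuple_cons R n)).
- by move=> t; rewrite lee_fin prodr_ge0.
transitivity (\int[unit_interval_measure]_x
    ((phi ord0 x)%:E * (\prod_(i < n) c (lift ord0 i))%:E))%E.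
  apply: eq_integral => x _.
  rewrite /fubini_F /=.
  transitivity (\int[cube_measure n]_t ((phi ord0 x)%:E *
      (\prod_(i < n) phi (lift ord0 i) (tnth t i))%:E))%E.
    apply: eq_integral => t _.
    by rewrite big_ord_recl -EFinM; under eq_bigr do rewrite tnthS.
  rewrite ge0_integralZl_EFin//; last 2 first.
  - by move=> t _; rewrite lee_fin prodr_ge0.
  - by apply/measurable_EFinP;
      exact: (@measurable_prod_tnth n (fun i => phi (lift ord0 i))).
  by rewrite (IH (fun i => phi (lift ord0 i)) (c \o lift ord0)).
rewrite big_ord_recl EFinM -phic ge0_integralZr//.
- exact/measurable_EFinP.
- by move=> x _; rewrite lee_fin.
- rewrite lee_fin prodr_ge0// => i _; rewrite -lee_fin -phic.
  by apply: integral_ge0 => x _; rewrite lee_fin.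
Qed.

End cube_measure_theory.

Section product_sets.
Variable R : realType.

Lemma measurable_product_set n (A : 'I_n -> set (measurableTypeR R)) :
  (forall i, measurable (A i)) ->
  measurable ([set t | forall i, A i (tnth t i)] :
    set (n.-tuple (measurableTypeR R))).
Proof.
move=> mA.
have -> : [set t | forall i, A i (tnth t i)] =
    \bigcap_(i in [set: 'I_n]) ((@tnth n (measurableTypeR R))^~ i @^-1` A i).
  by apply/seteqP; split => [t At i _|t At i]; exact: At.
apply: fin_bigcap_measurable => // i _.
rewrite -[X in measurable X]setTI.
exact: (@measurable_tnth _ (measurableTypeR R) n i).
Qed.

Lemma cube_measure_product_set n (A : 'I_n -> set (measurableTypeR R))
    (c : 'I_n -> R) :
  (forall i, measurable (A i)) ->
  (forall i, unit_interval_measure (A i) = (c i)%:E) ->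
  cube_measure n [set t | forall i, A i (tnth t i)] = (\prod_(i < n) c i)%:E.
Proof.
move=> mA Ac.
rewrite -[X in cube_measure n X]setIT -integral_indic//; last first.
  exact: measurable_product_set.
rewrite -(@integral_cube_prod R n (fun i => \1_(A i)) c).
- apply: eq_integral => t _; congr EFin.
  rewrite indicE; have [At|nAt] := pselect (forall i, A i (tnth t i)).
    by rewrite mem_set// big1// => i _; rewrite indicE mem_set.
  rewrite memNset//; move/existsNP : nAt => [i nAi].
  by rewrite (bigD1 i)//= indicE memNset// mul0r.
- by move=> i; exact: measurable_indic.
- by move=> i x; rewrite indicE; case: (_ \in _).
- move=> i; rewrite integral_indic ?setIT; [exact: Ac|exact: measurableT|exact: mA].
Qed.

Lemma unit_interval_measure_itv (b0 b1 : bool) (x y : R) :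
  0 <= x -> x <= y -> y <= 1 ->
  unit_interval_measure [set` Interval (BSide b0 x) (BSide b1 y)] = (y - x)%:E.
Proof.
move=> x0 xy y1.
transitivity (lebesgue_measure
  ([set` Interval (BSide b0 x) (BSide b1 y)] `&` `[0%R, 1%R])); first by [].
rewrite setIidl; last first.
  move=> z /=; rewrite !in_itv/=.
  case: b0 b1 => [] [] /=; rewrite ?bnd_simp => /andP[a b]; apply/andP; split;
    by [apply: le_trans a|apply: le_trans y1; apply: ltW|
        apply: (le_trans x0 (ltW a))|apply: le_trans y1].
rewrite lebesgue_measure_itv/= lte_fin; case: ltP => [//|yx].
by rewrite (@le_anti _ _ x y) ?subrr// xy.
Qed.

Lemma anchored_boxE n (y : n.-tuple R) :
  anchored_box y = [set t | forall i, (`[0%R, tnth y i[%classic : set R) (tnth t i)].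
Proof. by apply/seteqP; split => t ty i; have := ty i; rewrite /= in_itv. Qed.

Lemma measurable_anchored_box n (y : n.-tuple R) :
  measurable (anchored_box y : set (n.-tuple (measurableTypeR R))).
Proof.
rewrite anchored_boxE.
apply: (@measurable_product_set n (fun i => `[0%R, tnth y i[%classic)) => i.
exact: measurable_itv.
Qed.

Lemma cube_measure_anchored_box n (y : n.-tuple R) : unit_cube n y ->
  cube_measure n (anchored_box y) = (\prod_(i < n) tnth y i)%:E.
Proof.
move=> yc; rewrite anchored_boxE.
apply: (@cube_measure_product_set n (fun i => `[0%R, tnth y i[%classic)).
  by move=> i; exact: measurable_itv.
move=> i; have /andP[y0 y1] := yc i.
by rewrite unit_interval_measure_itv// subr0.
Qed.

(** The box with corner (1, ..., 1) is the half-open cube [0, 1)^n, which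
    carries the whole mass. *)
Lemma cube_measure_half_open n :
  cube_measure n (~` anchored_box [tuple (1 : R) | _ < n]) = 0%E.
Proof.
rewrite probability_setC; last exact: measurable_anchored_box.
rewrite cube_measure_anchored_box.
  rewrite big1 ?subee// => i _.
  by rewrite tnth_mktuple.
by move=> i; rewrite tnth_mktuple ler01 lexx.
Qed.

End product_sets.

(** * Uniqueness of densities *)

Section density_uniqueness.

(** The integral of h over A is a signed measure in A, so the sets on which it
    vanishes form a Dynkin system as soon as it vanishes on the whole space. *)
Lemma ae_eq0_of_pi_system d (T : measurableType d) (R : realType)
    (mu : {measure set T -> \bar R}) (G : set (set T)) (h : T -> \bar R) :
  measurable = <<s G >> -> setI_closed G -> mu.-integrable setT h ->
  (\int[mu]_x h x = 0)%E ->
  (forall A, G A -> (\int[mu]_(x in A) h x = 0)%E) ->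
  ae_eq mu setT h (cst 0%E).
Proof.
move=> mG GI ih hT hG.
pose E := [set A | measurable A /\ (\int[mu]_(x in A) h x = 0)%E].
have sub : measurable `<=` E.
  rewrite mG -(setI_closed_g_dynkin_g_sigma_algebra GI).
  apply: smallest_sub; last first.
    by move=> A GA; split; [rewrite mG; exact: sub_sigma_algebra|exact: hG].
  split.
  - by split.
  - move=> A [mA A0]; split; first exact: measurableC.
    have : induced_charge ih (A `|` ~` A) =
        (induced_charge ih A + induced_charge ih (~` A))%E.
      by apply: chargeU => //; [exact: measurableC|rewrite setICr].
    by rewrite setUCr /induced_charge hT A0 add0e => <-.
  - move=> F tF FE.
    have mF k : measurable (F k) by have [] := FE k.
    split; first exact: bigcupT_measurable.
    have := @charge_semi_sigma_additive _ _ _ (induced_charge ih) F mF tF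
      (bigcupT_measurable _ mF).
    have -> : (fun n => \sum_(0 <= i < n) induced_charge ih (F i))%E = cst 0%E.
      apply/funext => n; rewrite big1// => i _.
      by have [] := FE i.
    move=> /cvg_lim F0; rewrite -[LHS]/(induced_charge ih (\bigcup_k F k)).
    by rewrite -F0// lim_cst.
apply: integral_ae_eq => //.
  by move=> A _ /sub[_ ->]; rewrite integral0.
Qed.

Variable R : realType.

(** The anchored boxes do not separate points with a negative coordinate, hence
    do not generate the Borel sets of R^n; these orthants do, and differ from
    anchored boxes by null sets only. *)
Definition lower_orthants n : set (set (n.-tuple (measurableTypeR R))) :=
  [set A | exists y : n.-tuple R, A = [set t | forall i, tnth t i < tnth y i]].

Lemma setI_closed_lower_orthants n : setI_closed (@lower_orthants n).
Proof.
move=> _ _ [y ->] [z ->]; exists [tuple Num.min (tnth y i) (tnth z i) | i < n].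
apply/seteqP; split => [t [ty tz] i|t tyz].
  by rewrite tnth_mktuple lt_min ty tz.
by split => i; have := tyz i; rewrite tnth_mktuple lt_min => /andP[].
Qed.

Lemma measurable_lower_orthants n :
  @measurable _ (n.-tuple (measurableTypeR R)) = <<s @lower_orthants n >>.
Proof.
apply/seteqP; split; last first.
  apply: smallest_sub; first exact: sigma_algebra_measurable.
  move=> _ [y ->]; apply: (@measurable_product_set R n
    (fun i => `]-oo, tnth y i[%classic)) => i.
  exact: measurable_itv.
pose T := g_sigma_algebraType (@lower_orthants n).
have mtnth i : measurable_fun setT (fun t : T => tnth t i : measurableTypeR R).
  apply: (measurability _ (RGenInftyO.measurableE R)).
  move=> _ [_ [x ->] <-]; rewrite setTI.
  (* The half-space t_i < x is the union over k of the orthants whose corner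
     has x as its i-th coordinate and k as all the others. *)
  have -> : (fun t : T => tnth t i) @^-1` `]-oo, x[ =
      \bigcup_k ([set t | forall j, tnth t j < (if j == i then x else k%:R)]).
    apply/seteqP; split => [t /=|t [k _ /(_ i)]]; last first.
      by rewrite /= eqxx in_itv.
    rewrite in_itv/= => tx.
    exists (Num.bound (\sum_j `|tnth t j|)) => // j.
    case: ifP => [/eqP -> //|_].
    apply: le_lt_trans (archi_boundP _); last exact: sumr_ge0.
    apply: le_trans (ler_norm _) _.
    by rewrite (bigD1 j)//= lerDl sumr_ge0.
  apply: bigcupT_measurable => k; apply: sub_sigma_algebra.
  exists [tuple if j == i then x else k%:R | j < n].
  by apply/seteqP; split => t tx j; have := tx j; rewrite tnth_mktuple.
apply: smallest_sub; first exact: smallest_sigma_algebra.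
rewrite -bigcup_seq/= => _ [i _ [B mB <-]].
exact: (mtnth i measurableT).
Qed.

(** Uniqueness of densities on the cube. Intersected with [0, 1)^n, which only
    removes a null set, an orthant becomes the anchored box whose corner is
    obtained by clamping every coordinate to [0, 1]. *)
Lemma ae_eq0_of_anchored_boxes n (h : n.-tuple (measurableTypeR R) -> R) :
  (cube_measure n).-integrable setT (EFin \o h) ->
  (forall y : n.-tuple R, unit_cube n y ->
    \int[cube_measure n]_(t in anchored_box y) h t = 0) ->
  ae_eq (cube_measure n) setT (EFin \o h) (cst 0%E).
Proof.
move=> ih h0.
pose Q := anchored_box [tuple (1 : R) | _ < n].
have mQ : measurable (Q : set (n.-tuple (measurableTypeR R))).
  exact: measurable_anchored_box.
have toQ A : measurable A -> (\int[cube_measure n]_(x in A) (EFin \o h) x =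
    \int[cube_measure n]_(x in A `&` Q) (EFin \o h) x)%E.
  move=> mA; rewrite (negligible_integral (measurableC mQ))//.
  - by rewrite setDE setCK.
  - exact: integrableS ih.
  - exact: cube_measure_half_open.
have box0 y : unit_cube n y ->
    (\int[cube_measure n]_(x in anchored_box y) (EFin \o h) x = 0)%E.
  move=> yc; rewrite -[LHS]fineK; first by congr EFin; exact: h0.
  apply: integrable_fin_num; first exact: measurable_anchored_box.
  by apply: integrableS ih => //; exact: measurable_anchored_box.
apply: (@ae_eq0_of_pi_system _ _ _ _ (@lower_orthants n)) => //.
- exact: measurable_lower_orthants.
- exact: setI_closed_lower_orthants.
- rewrite toQ// setTI; apply: box0 => i.
  by rewrite tnth_mktuple ler01 lexx.
- move=> A [y Ay]; rewrite toQ; last first.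
    by rewrite measurable_lower_orthants; apply: sub_sigma_algebra; exists y.
  have -> : A `&` Q =
      anchored_box [tuple Num.max 0 (Num.min 1 (tnth y i)) | i < n].
    rewrite Ay; apply/seteqP; split => [t [ty tQ] i|t ty].
      have := tQ i; rewrite !tnth_mktuple lt_max lt_min (ty i) andbT.
      by case/andP => -> ->; rewrite orbT.
    by split => i; have := ty i; rewrite ?tnth_mktuple lt_max lt_min;
       case: (ltP (tnth t i) 0) => [t0 /andP[]|t0 /andP[_ /=/andP[]]//];
       rewrite ?leNgt ?t0.
  apply: box0 => i; rewrite tnth_mktuple le_max lexx/=.
  by rewrite ge_max ler01/= ge_min lexx.
Qed.

End density_uniqueness.

(** * Powers, suprema and L_q norms *)

Section power_integral.
Variable R : realType.

Lemma powR_LRcontinuous (a : R) : 0 < a ->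
  derivable_oo_LRcontinuous (fun x : R => x `^ a) 0 1.
Proof.
move=> a0; split.
- move=> x /[!in_itv]/= /andP[x0 _]; apply: derivable_powR.
  by rewrite in_itv/= x0.
- by rewrite powR0 ?gt_eqF//; exact: powR_cvg0.
- apply: cvg_at_left_filter.
  have : differentiable (fun x : R => x `^ a) (1 : R).
    by apply/derivable1_diffP/derivable_powR; rewrite in_itv/= ltr01.
  by move/differentiable_continuous.
Qed.

(** The primitive of (a + 1) x^a is x^(a + 1). It is differentiable inside the
    interval only, so the fundamental theorem of calculus is used with one-sided
    continuity at 0 and 1. *)
Lemma integral_unit_interval_powR (a : R) : 0 < a ->
  (\int[unit_interval_measure]_x (x `^ a)%:E = ((a + 1)^-1)%:E)%E.
Proof.
move=> a0; have a10 : 0 < a + 1 by rewrite addr_gt0.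
have mp : measurable_fun setT (fun x : measurableTypeR R => x `^ a).
  exact: measurable_powR.
have : (\int[lebesgue_measure]_(x in `[0%R, 1%R]) ((a + 1) * x `^ a)%:E = 1)%E.
  rewrite (@continuous_FTC2 _ _ (fun x : R => x `^ (a + 1)))//.
  - by rewrite powR1 powR0 ?gt_eqF// sube0.
  - move=> x; apply: cvgM; first exact: cvg_cst.
    exact: derivable_oo_LRcontinuous_within (powR_LRcontinuous a0) x.
  - exact: powR_LRcontinuous.
  - move=> x /[!in_itv]/= /andP[x0 _]; rewrite powR_derive1 ?in_itv/= ?x0//.
    by rewrite addrK.
rewrite -integral_unit_interval; last 2 first.
- exact: measurable_funM.
- by move=> x; rewrite mulr_ge0 ?powR_ge0 ?ltW.
under eq_integral do rewrite EFinM.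
rewrite ge0_integralZl//; last 3 first.
- exact/measurable_EFinP.
- by move=> x _; rewrite lee_fin powR_ge0.
- by rewrite lee_fin ltW.
set I := integral _ _ _ => aI.
have Ifin : I \is a fin_num.
  have I0 : (0 <= I)%E by apply: integral_ge0 => x _; rewrite lee_fin powR_ge0.
  rewrite ge0_fin_numE// ltey; apply/eqP => Iy.
  by move: aI; rewrite Iy gt0_muley// lte_fin.
move: aI; rewrite -(fineK Ifin) -EFinM => -[aI]; congr EFin.
by apply: (mulfI (lt0r_neq0 a10)); rewrite aI divff// gt_eqF.
Qed.

End power_integral.

Section Lnorm_monotone.
Context d (T : measurableType d) (R : realType) (mu : {measure set T -> \bar R}).
Local Open Scope ereal_scope.

(** The integral of a nonnegative function is a supremum over the simple
    functions below it, which makes it monotone on all functions. Hence the L_q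
    norms of elements of F_u can be estimated pointwise, whether or not these
    functions have been shown to be measurable. *)
Lemma ge0_le_integralT (f g : T -> \bar R) :
  (forall x, 0 <= f x) -> (forall x, f x <= g x) ->
  \int[mu]_x f x <= \int[mu]_x g x.
Proof.
move=> f0 fg; rewrite !ge0_integralTE//; last first.
  by move=> x; exact: le_trans (fg x).
apply: ereal_sup_le => _ [h hf <-]; exists h => // x.
exact: le_trans (fg x).
Qed.

Lemma le_Lnorm (q : \bar R) (f g : T -> \bar R) : 1 <= q ->
  (forall x, `|f x| <= `|g x|) -> 'N[mu]_q[f] <= 'N[mu]_q[g].
Proof.
move=> q1 fg; rewrite unlock; case: q q1 => [t| |//] t1.
  have t0 : (0 <= t)%R by rewrite (le_trans ler01).
  apply: gt0_ler_poweR; rewrite ?invr_ge0 ?in_itv/= ?leey ?andbT//.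
  - by apply: integral_ge0 => x _; exact: poweR_ge0.
  - by apply: integral_ge0 => x _; exact: poweR_ge0.
  apply: ge0_le_integralT => x; first exact: poweR_ge0.
  by apply: gt0_ler_poweR; rewrite ?in_itv/= ?leey ?abse_ge0.
by case: ifP => // _; apply: le_ess_sup; apply: nearW => x /=; exact: fg.
Qed.

End Lnorm_monotone.

Lemma prodr_powR (R : realType) (I : Type) (s : seq I) (F : I -> R) (a : R) :
  (forall i, 0 <= F i) ->
  \prod_(i <- s) (F i `^ a) = (\prod_(i <- s) F i) `^ a.
Proof.
move=> F0; elim: s => [|i s IH]; first by rewrite !big_nil powR1.
by rewrite !big_cons IH powRM// prodr_ge0.
Qed.

Lemma Lnorm_pinfty d (T : measurableType d) (R : realType)
    (P : probability T R) (f : T -> \bar R) :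
  'N[P]_+oo[f]%E = ess_sup P (abse \o f).
Proof.
have PT : (0 < P [set: T])%E by rewrite probability_setT lte01.
by rewrite unlock; case: ifPn => //; rewrite PT.
Qed.

Lemma Lnorm_indic d (T : measurableType d) (R : realType)
    (mu : {measure set T -> \bar R}) (A : set T) (t : R) :
  measurable A -> 0 < t ->
  'N[mu]_t%:E[EFin \o \1_A]%E = (mu A `^ t^-1)%E.
Proof.
move=> mA t0; rewrite unlock; congr poweR.
rewrite -[X in mu X]setIT -integral_indic//; apply: eq_integral => x _ /=.
by rewrite indicE; case: (x \in A); rewrite ?normr1 ?powR1// normr0 powR0 ?gt_eqF.
Qed.

(** * Estimates for functions given by a density *)

Section density_bounds.
Variable R : realType.

Lemma normr_box_integral1 n (g : n.-tuple R -> R) (y : n.-tuple R) :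
  g \in Lfun (cube_measure n) 1%E ->
  (`|\int[cube_measure n]_(t in anchored_box y) g t|%:E <=
   'N[cube_measure n]_1[EFin \o g])%E.
Proof.
move=> /Lfun1_integrable ig.
have mB := @measurable_anchored_box R n y.
have igB := integrableS measurableT mB (@subsetT _ _) ig.
have mg := measurable_int _ ig.
rewrite EFin_normr_Rintegral//; apply: le_trans (le_abse_integral _ mB _) _.
  exact: measurable_int igB.
rewrite Lnorm1; apply: ge0_subset_integral => //.
exact: measurableT_comp.
Qed.

Lemma hoelder_conjugate_fine (p : \bar R) : (1 < p)%E ->
  exists2 r : R, hoelder_conjugate p = r%:E & 0 < r.
Proof.
case: p => [a| |//]; last by exists 1 => //; exact: hoelder_conjugatey.
rewrite lte_fin => a1; exists (a / (a - 1)).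
  rewrite /hoelder_conjugate/= eqe gt_eqF ?(lt_trans _ a1)//.
  by rewrite -EFinD inver subr_eq0 gt_eqF// -EFinM.
by rewrite divr_gt0 ?subr_gt0// (lt_trans _ a1).
Qed.

Lemma hoelder_conjugate_fineV (a : R) : 1 < a ->
  a^-1 + (fine (hoelder_conjugate a%:E))^-1 = 1.
Proof.
move=> a1; have a0 : a != 0 by rewrite gt_eqF// (lt_trans _ a1).
rewrite /hoelder_conjugate/= eqe (negbTE a0) -EFinD inver subr_eq0 gt_eqF//=.
by rewrite invf_div mulrBl mul1r divff// addrC subrK.
Qed.

(** Hoelder's inequality against the indicator function of the box, whose norm
    for the conjugate exponent r is the r-th root of the volume of the box. If
    p = +oo, then r = 1 and the integral is at most the essential supremum times
    the volume. *)
Lemma normr_box_integral p n (g : n.-tuple R -> R) (y : n.-tuple R) (M : R) :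
  (1 < p)%E -> g \in Lfun (cube_measure n) 1%E -> unit_cube n y ->
  ('N[cube_measure n]_p[EFin \o g] = M%:E)%E ->
  `|\int[cube_measure n]_(t in anchored_box y) g t| <=
  M * \prod_(i < n) tnth y i `^ (fine (hoelder_conjugate p))^-1.
Proof.
move=> p1 /Lfun1_integrable ig yc gM.
have mB := @measurable_anchored_box R n y.
have igB := integrableS measurableT mB (@subsetT _ _) ig.
have mg := measurable_int _ ig.
have mg' : measurable_fun setT g by exact/measurable_EFinP.
have M0 : (0 <= M%:E)%E by rewrite -gM Lnorm_ge0.
have y0 i : 0 <= tnth y i by have /andP[] := yc i.
rewrite -lee_fin EFin_normr_Rintegral//.
apply: le_trans (le_abse_integral _ mB (measurable_int _ igB)) _.
rewrite prodr_powR//.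
case: p p1 gM => [a| |//]; last first.
  move=> _; rewrite Lnorm_pinfty hoelder_conjugatey invr1.
  rewrite powRr1 ?prodr_ge0// => gM.
  have gae : \forall x \ae cube_measure n, (`|(EFin \o g) x| <= M%:E)%E.
    by apply/ess_supP; rewrite -gM.
  apply: (@le_trans _ _ (\int[cube_measure n]_(x in anchored_box y) M%:E)%E).
    apply: ae_ge0_le_integral => //.
    - apply: measurableT_comp => //; exact: measurable_int igB.
    - have [N [mN N0 gN]] := gae; exists N; split => // x /= xB.
      by apply: gN => /= gx; exact: xB.
  by rewrite integral_cst// EFinM -(cube_measure_anchored_box yc).
rewrite lte_fin => a1 gM.
have a0 : 0 < a by rewrite (lt_trans _ a1).
have a1' : (1 < a%:E)%E by rewrite lte_fin.
have [r rE r0] := hoelder_conjugate_fine a1'.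
have := hoelder_conjugate_fineV a1; rewrite rE/= => ar.
rewrite EFinM -gM muleC.
have -> : ((\prod_(i < n) tnth y i) `^ r^-1)%:E =
    'N[cube_measure n]_r%:E[EFin \o \1_(anchored_box y)]%E.
  by rewrite -poweR_EFin -(cube_measure_anchored_box yc) -Lnorm_indic.
apply: le_trans (hoelder _ (measurable_indic mB) mg' r0 a0 _); last first.
  by rewrite addrC.
rewrite [leLHS]integral_mkcond Lnorm1; apply: ge0_le_integralT => x.
  by apply: erestrict_ge0 => z _.
rewrite patchE /= indicE; case: (x \in _); first by rewrite mul1r.
by rewrite mul0r normr0.
Qed.

End density_bounds.

Section Lnorm_bounds.
Variable R : realType.

Lemma Lnorm_le_bound d (T : measurableType d) (P : probability T R)
    (q : \bar R) (f : T -> R) (M : R) :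
  (1 <= q)%E -> 0 <= M -> (forall x, `|f x| <= M) ->
  ('N[P]_q[EFin \o f] <= M%:E)%E.
Proof.
move=> q1 M0 fM.
apply: (@le_trans _ _ 'N[P]_q[cst M%:E]%E).
  by apply: le_Lnorm => // x /=; rewrite lee_fin (ger0_norm M0).
case: q q1 => [t| |//].
  rewrite lee_fin => t1; have t0 : t != 0 by rewrite gt_eqF// (lt_le_trans _ t1).
  rewrite unlock; under eq_integral do rewrite /= (ger0_norm M0).
  rewrite integral_cst// [X in ((_ * X) `^ _)%E](probability_setT P).
  by rewrite mule1 poweR_EFin -powRrM mulfV// powRr1.
move=> _; rewrite Lnorm_pinfty; apply/ess_supP; apply: nearW => x /=.
by rewrite (ger0_norm M0).
Qed.

Lemma anchored_const_gt0 (q : \bar R) (r : R) n :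
  (1 <= q)%E -> 0 < r -> 0 < anchored_const q r n.
Proof.
case: q => [t| |//] //=; rewrite lee_fin => t1 r0.
by rewrite powR_gt0// addr_gt0// divr_gt0// (lt_le_trans _ t1).
Qed.

Lemma prod_anchored_const (t r : R) n : 0 < t -> 0 < r ->
  (\prod_(i < n) (t / r + 1)^-1) `^ t^-1 =
  anchored_const t%:E r n `^ (- r^-1).
Proof.
move=> t0 r0; have : 0 < t / r + 1 by rewrite addr_gt0// divr_gt0.
rewrite prodr_const card_ord /anchored_const.
move: (t / r + 1) => c c0.
have -> : c^-1 ^+ n = c `^ (- n%:R) by rewrite powR_invn ?ltW// exprVn.
rewrite -powRrM -powRrM; congr (c `^ _).
by rewrite mulrN mulNr -[r * _ / t]mulrA mulrAC mulfV ?gt_eqF// mul1r.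
Qed.

(** For finite q the q-th power of the majorant is a product over the
    coordinates, each of which contributes the integral of x^(q / r) over
    [0, 1], that is 1 / (q / r + 1). For q = +oo the product is at most 1. The
    power - 1 / r turns anchored_const, which is the r-th power of the inverse
    of the norm, into the norm itself. *)
Lemma Lnorm_le_anchored_const (q : \bar R) (r M : R) n (f : n.-tuple R -> R) :
  (1 <= q)%E -> 0 < r -> 0 <= M ->
  (forall y, unit_cube n y ->
     `|f y| <= M * \prod_(i < n) tnth y i `^ r^-1) ->
  (forall y, ~ unit_cube n y -> f y = 0) ->
  ('N[cube_measure n]_q[EFin \o f] <=
   (M * anchored_const q r n `^ (- r^-1))%:E)%E.
Proof.
move=> q1 r0 M0 fM f0.
have fM' y : `|f y| <= M * \prod_(i < n) tnth y i `^ r^-1.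
  have [/fM//|/f0 ->] := pselect (unit_cube n y).
  by rewrite normr0 mulr_ge0// prodr_ge0// => i _; exact: powR_ge0.
case: q q1 => [t| |//]; last first.
  move=> q1; rewrite /= powR1 mulr1; apply: Lnorm_le_bound => // y.
  have [yc|/f0 ->] := pselect (unit_cube n y); last by rewrite normr0.
  apply: le_trans (fM' y) _; rewrite ler_piMr//.
  apply: prodr_ile1 => i _; rewrite powR_ge0/=.
  have /andP[y0 y1] := yc i.
  have -> : 1 = 1 `^ r^-1 :> R by rewrite powR1.
  by rewrite ge0_ler_powR ?invr_ge0 ?nnegrE// ltW.
move=> t1; have t0 : 0 < t by rewrite -lte_fin (lt_le_trans _ t1)// lte01.
pose G (y : n.-tuple R) : R := M * \prod_(i < n) tnth y i `^ r^-1.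
have fG : ('N[cube_measure n]_t%:E[EFin \o f] <=
    'N[cube_measure n]_t%:E[EFin \o G])%E.
  apply: le_Lnorm => // y /=; rewrite lee_fin [leRHS]ger0_norm//.
  by rewrite mulr_ge0// prodr_ge0// => i _; exact: powR_ge0.
apply: le_trans fG _.
set c := t / r + 1.
have c0 : 0 < c by rewrite addr_gt0// divr_gt0.
have -> : 'N[cube_measure n]_t%:E[EFin \o G]%E =
    ((M `^ t * \prod_(i < n) c^-1)%:E `^ t^-1)%E.
  rewrite unlock; congr poweR.
  transitivity (\int[cube_measure n]_y
      ((M `^ t)%:E * (\prod_(i < n) (tnth y i `^ (t / r)))%:E))%E.
    apply: eq_integral => y _ /=; rewrite -EFinM; congr EFin.
    rewrite ger0_norm; last first.
      by rewrite mulr_ge0// prodr_ge0// => i _; exact: powR_ge0.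
    rewrite powRM//; last by rewrite prodr_ge0// => i _; exact: powR_ge0.
    congr (_ * _); rewrite -prodr_powR; last by move=> i; exact: powR_ge0.
    by apply: eq_bigr => i _; rewrite -powRrM [_ * t]mulrC.
  have mphi : 'I_n -> measurable_fun setT
      (fun x : measurableTypeR R => x `^ (t / r)).
    by move=> _; exact: measurable_powR.
  rewrite ge0_integralZl//.
  - rewrite (@integral_cube_prod R n (fun _ x => x `^ (t / r)) (fun=> c^-1))//.
    + by move=> i x; exact: powR_ge0.
    + by move=> i; rewrite integral_unit_interval_powR// divr_gt0.
  - by apply/measurable_EFinP; exact: measurable_prod_tnth mphi.
  - by move=> y _; rewrite lee_fin prodr_ge0// => i _; exact: powR_ge0.
  - by rewrite lee_fin powR_ge0.
rewrite poweR_EFin lee_fin le_eqVlt; apply/orP; left; apply/eqP.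
rewrite powRM ?powR_ge0//; last by rewrite prodr_ge0// => i _; rewrite invr_ge0 ltW.
rewrite -powRrM mulfV ?gt_eqF// powRr1//; congr (_ * _).
exact: prod_anchored_const.
Qed.

End Lnorm_bounds.

(** * Anchoring, primitives and mixed increments *)

Section geometry.
Variables (R : realType) (s : nat).
Implicit Types (u v w : {set 'I_s}).

Lemma tnth_embed u (y : #|u|.-tuple R) i : tnth (embed y) (enum_val i) = tnth y i.
Proof.
rewrite tnth_mktuple (bigD1 i)//= big1 ?addr0// => j /andP[/eqP/enum_val_inj ->].
by rewrite eqxx.
Qed.

Lemma tnth_embed_notin u (y : #|u|.-tuple R) j : j \notin u ->
  tnth (embed y) j = 0.
Proof.
move=> ju; rewrite tnth_mktuple big1// => i /eqP ij.
by move: ju; rewrite -ij enum_valP.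
Qed.

Lemma restr_embed u (y : #|u|.-tuple R) : restr u (embed y) = y.
Proof. by apply: eq_from_tnth => i; rewrite tnth_mktuple tnth_embed. Qed.

Lemma unit_cube_embed u (y : #|u|.-tuple R) :
  unit_cube s (embed y) <-> unit_cube #|u| y.
Proof.
split => yc i; first by rewrite -tnth_embed; exact: yc.
have [iu|iu] := boolP (i \in u); last first.
  by rewrite tnth_embed_notin// lexx ler01.
by rewrite -(enum_rankK_in iu iu) tnth_embed; exact: yc.
Qed.

Lemma unit_cube_anchor u (x : s.-tuple R) : unit_cube s x -> unit_cube s (anchor u x).
Proof.
by move=> xc i; rewrite tnth_mktuple; case: ifP => _; [exact: xc|rewrite lexx ler01].
Qed.

(** The elements of F_u are of this form, with mixed derivative g. *)
Definition box_primitive u (g : #|u|.-tuple R -> R) : s.-tuple R -> R :=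
  (fun x => \int[cube_measure #|u|]_(t in anchored_box (restr u x)) g t)
    \_ (unit_cube s).

Lemma box_primitiveE u (g : #|u|.-tuple R -> R) x : unit_cube s x ->
  box_primitive g x = \int[cube_measure #|u|]_(t in anchored_box (restr u x)) g t.
Proof. by move=> xc; rewrite /box_primitive patchE mem_set. Qed.

Lemma box_primitive_out u (g : #|u|.-tuple R -> R) x : ~ unit_cube s x ->
  box_primitive g x = 0.
Proof. by move=> xc; rewrite /box_primitive patchE memNset. Qed.

Lemma box_primitive_embed u (g : #|u|.-tuple R -> R) y : unit_cube #|u| y ->
  box_primitive g (embed y) = \int[cube_measure #|u|]_(t in anchored_box y) g t.
Proof.
by move=> yc; rewrite box_primitiveE ?restr_embed//; exact/unit_cube_embed.
Qed.

Lemma box_primitive_embed_out u (g : #|u|.-tuple R -> R) y :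
  ~ unit_cube #|u| y -> box_primitive g (embed y) = 0.
Proof. by move=> yc; apply: box_primitive_out => /unit_cube_embed. Qed.

(** If u is not contained in v, one side of the box of integration is the empty
    interval [0, 0). *)
Lemma box_primitive_anchor u v (g : #|u|.-tuple R -> R) x : unit_cube s x ->
  box_primitive g (anchor v x) = if u \subset v then box_primitive g x else 0.
Proof.
move=> xc; rewrite box_primitiveE; last exact: unit_cube_anchor.
case: ifPn => [uv|/fintype.subsetPn[j ju jv]].
  have -> : restr u (anchor v x) = restr u x.
    apply: eq_from_tnth => i; rewrite !tnth_mktuple.
    by rewrite (fintype.subsetP uv _ (enum_valP i)).
  by rewrite box_primitiveE.
have -> : anchored_box (restr u (anchor v x)) = set0.
  apply/seteqP; split => // t /(_ (enum_rank_in ju j)) /andP[t0].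
  rewrite !tnth_mktuple enum_rankK_in// (negbTE jv) => tl0.
  by have := le_lt_trans t0 tl0; rewrite ltxx.
exact: Rintegral_set0.
Qed.

(** Expand the product of the F i + G i over all coordinates i: the term of the
    expansion that takes F on v and G off v is the sign of v if v lies between u
    and w, and 0 otherwise. On the other hand F i + G i is 1 if i belongs to
    both or to none of u and w, and 0 otherwise. *)
Lemma sum_sign_interval u w :
  \sum_(v : {set 'I_s} | (u \subset v) && (v \subset w)) (-1) ^+ #|w :\: v|
  = (u == w)%:R :> R.
Proof.
pose F i : R := (i \in w)%:R.
pose G i : R := if i \in u then 0 else if i \in w then -1 else 1.
have -> : (u == w)%:R = \prod_i (F i + G i).
  case: eqVneq => uw.
    by rewrite big1// => i _; rewrite /F /G uw; case: (i \in w); rewrite ?addr0 ?add0r.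
  have [i iuw] : exists i, (i \in u) != (i \in w).
    apply/existsP; apply: contraNT uw; rewrite negb_exists => /forallP h.
    by apply/eqP/setP => i; apply/eqP; have := h i; rewrite negbK.
  rewrite (bigD1 i)//= /F /G.
  by case: (i \in u) (i \in w) iuw => [] [] //; rewrite ?addr0 ?subrr mul0r.
rewrite bigA_distr big_mkcond/=; apply: eq_bigr => v _.
case: ifPn => [/andP[uv vw]|].
  rewrite -prodr_const big_mkcond/=; apply: eq_bigr => i _.
  rewrite inE /F /G; have [iv|iv]/= := boolP (i \in v).
    by rewrite (fintype.subsetP vw _ iv).
  by rewrite [i \in u](contraNF (fintype.subsetP uv i) iv).
rewrite negb_and => /orP[] /fintype.subsetPn[i i1 i2]; rewrite (bigD1 i)//=.
  by rewrite (negbTE i2) /G i1 mul0r.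
by rewrite i1 /F (negbTE i2) mul0r.
Qed.

(** The mixed increments isolate one component of an anchored decomposition:
    anchoring the point at v keeps the components with index contained in v,
    and the signs of the sets v between u and w cancel unless u = w. *)
Lemma increment_sum_box_primitive (P : pred {set 'I_s})
    (g : forall u, #|u|.-tuple R -> R) w x : unit_cube s x ->
  \sum_(v : {set 'I_s} | v \subset w) (-1) ^+ #|w :\: v| *
     (\sum_(u | P u) box_primitive (g u) (anchor v x))
  = if P w then box_primitive (g w) x else 0.
Proof.
move=> xc.
transitivity (\sum_(u | P u) box_primitive (g u) x * (u == w)%:R).
  under eq_bigr do rewrite big_distrr/=.
  rewrite exchange_big/=; apply: eq_bigr => u Pu.
  rewrite -sum_sign_interval big_distrr/=.
  rewrite [RHS](eq_bigl (fun v => (v \subset w) && (u \subset v))); last first.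
    by move=> v; rewrite andbC.
  rewrite [RHS]big_mkcondr/=; apply: eq_bigr => v vw.
  by rewrite box_primitive_anchor//; case: ifP; rewrite ?mulr0// mulrC.
case: ifPn => Pw; last first.
  rewrite big1// => u Pu; case: eqVneq => [uw|]; rewrite ?mulr0//.
  by rewrite -uw Pu in Pw.
rewrite (bigD1 w)//= eqxx mulr1 big1 ?addr0// => u /andP[_ /negbTE ->].
by rewrite mulr0.
Qed.

End geometry.

(** * Mixed derivatives of anchored decompositions *)

Section mixed_derivatives.
Variables (R : realType) (s : nat).
Implicit Types (u v w : {set 'I_s}) (p : \bar R).

Lemma Lfun_cube_subset1 p n (g : n.-tuple R -> R) : (1 <= p)%E ->
  g \in Lfun (cube_measure n) p -> g \in Lfun (cube_measure n) 1%E.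
Proof.
move=> p1; apply: Lfun_subset => //.
by rewrite (_ : _ [set: _] = 1%E)//; exact: probability_setT.
Qed.

(** mixed_derivative picks one among all the densities of the mixed increments.
    Whichever is picked, its primitive is the component of index w, if any. *)
Lemma mixed_derivative_sum (P : pred {set 'I_s})
    (g : forall u, #|u|.-tuple R -> R) w :
  (forall u, P u -> g u \in Lfun (cube_measure #|u|) 1%E) ->
  let f := fun x => \sum_(u | P u) box_primitive (g u) x in
  is_mixed_derivative f w (mixed_derivative f w) /\
  (P w -> box_primitive (mixed_derivative f w) = box_primitive (g w)).
Proof.
move=> gL f.
have df : is_mixed_derivative f w (mixed_derivative f w).
  apply: xgetPex; exists (if P w then g w else fun=> 0); split.
    case: ifPn => [Pw|_]; first exact: gL.
    apply/Lfun1_integrable; exact: integrable0.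
  move=> x xc; rewrite increment_sum_box_primitive//.
  case: ifPn => Pw; first by rewrite box_primitiveE.
  by rewrite /Rintegral integral0.
split=> // Pw; apply/funext => x.
have [xc|xc] := pselect (unit_cube s x); last by rewrite !box_primitive_out.
rewrite box_primitiveE//; case: df => _ /(_ x xc) <-.
by rewrite increment_sum_box_primitive// Pw.
Qed.

Lemma F_primitive p u f : (1 <= p)%E -> F_ p u f ->
  exists g, g \in Lfun (cube_measure #|u|) 1%E /\ f = box_primitive g.
Proof. by move=> p1 [g [gL _ ->]]; exists g; split=> //; exact: Lfun_cube_subset1 gL. Qed.

(** The derivative that enters the anchored norm of the tail is a density of
    c w, so Hoelder's inequality applies to it directly. *)
Lemma mixed_derivative_tail p (gamma : {set 'I_s} -> R) f c k w :
  (1 <= p)%E -> anchored_decomposition p gamma f c ->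
  let T := truncation_tail gamma c k in
  is_mixed_derivative T w (mixed_derivative T w) /\
  (0 < gamma w -> ~~ (w \subset first_coords k) ->
   c w = box_primitive (mixed_derivative T w)).
Proof.
move=> p1 [cF _] T.
pose g u := xget (fun=> 0) [set h : #|u|.-tuple R -> R |
  h \in Lfun (cube_measure #|u|) 1%E /\ c u = box_primitive h].
have gP u : 0 < gamma u ->
    g u \in Lfun (cube_measure #|u|) 1%E /\ c u = box_primitive (g u).
  by move=> /cF/(F_primitive p1) exg; exact: (xgetPex _ exg).
pose P u := (0 < gamma u) && ~~ (u \subset first_coords k).
have TE : T = (fun x => \sum_(u | P u) box_primitive (g u) x).
  apply/funext => x; apply: eq_bigr => u /andP[gu _].
  by have [_ {1}->] := gP u gu.
have [|dT dTw] := @mixed_derivative_sum P g w.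
  by move=> u /andP[/gP[]].
rewrite TE; split => // gw wk; rewrite dTw /P ?gw//.
by have [_] := gP w gw.
Qed.

Lemma F_0 p u : (1 <= p)%E -> F_ p u (fun=> 0).
Proof.
move=> p1; have p0 : p != 0%E.
  by rewrite gt_eqF// (lt_le_trans _ p1)// lte01.
have N0 : 'N[cube_measure #|u|]_p[cst 0%E]%E = 0%E :> \bar R by rewrite Lnorm0.
exists (fun=> 0); split.
- rewrite inE/=; apply/andP; split; rewrite inE//=.
  by rewrite /finite_norm N0.
- move=> e e0; exists (fun=> 0), (fun=> 0).
    exists 0%N, (fun=> 0), (fun _ _ => fun=> 0), (fun _ _ => fun=> 0); split.
    + by move=> [].
    + apply/funext => x; rewrite patchE; case: ifP => // _.
      by rewrite big_ord0.
    + by apply/funext => y; rewrite big_ord0.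
  rewrite (_ : EFin \o _ = cst 0%E) ?N0 ?lte_fin//.
  by apply/funext => y /=; rewrite subrr.
- apply/funext => x; rewrite patchE; case: ifP => // _.
  by rewrite /Rintegral integral0.
Qed.

End mixed_derivatives.

(** * The anchored norm *)

Section anchored_norm_theory.
Variables (R : realType) (s : nat) (gamma : {set 'I_s} -> R) (f : s.-tuple R -> R).
Implicit Types (u w : {set 'I_s}).

(** A component of infinite norm makes the right-hand side of the inequality for
    the tail infinite; the estimates below then deal with real numbers only. *)
Lemma anchored_norm_eqy (p : \bar R) u : (1 <= p)%E -> 0 < gamma u ->
  'N[cube_measure #|u|]_p[EFin \o mixed_derivative f u]%E = +oo%E ->
  anchored_norm p gamma f = +oo%E.
Proof.
move=> + gu; rewrite /anchored_norm.
case: p => [a| |//].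
  rewrite lee_fin => a1 Nu.
  have a0 : a != 0 by rewrite gt_eqF// (lt_le_trans _ a1).
  rewrite (bigD1 u)//= Nu poweRyr// gt0_muley; last first.
    by rewrite lte_fin powR_gt0.
  rewrite addye ?poweRyr ?invr_neq0//.
  rewrite gt_eqF// (lt_le_trans (ltNyr 0))// sume_ge0// => v _.
  by rewrite mule_ge0 ?poweR_ge0// lee_fin powR_ge0.
move=> _ Nu; apply/eqP; rewrite -leye_eq.
apply: le_trans (le_bigmax_cond _ _ gu) => /=.
by rewrite Nu gt0_muley// lte_fin invr_gt0.
Qed.

Lemma anchored_norm_EFin (a : R) (m : {set 'I_s} -> R) :
  (forall u, 0 < gamma u ->
    'N[cube_measure #|u|]_a%:E[EFin \o mixed_derivative f u]%E = (m u)%:E) ->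
  anchored_norm a%:E gamma f =
  ((\sum_(u | 0 < gamma u) gamma u `^ (- a) * m u `^ a) `^ a^-1)%:E.
Proof.
move=> Nm; rewrite /anchored_norm -poweR_EFin -sumEFin; congr poweR.
apply: eq_bigr => u gu.
by rewrite Nm.
Qed.

Lemma Lnorm_fin_family (p : \bar R) :
  ~ (exists2 u, 0 < gamma u &
      'N[cube_measure #|u|]_p[EFin \o mixed_derivative f u]%E = +oo%E) ->
  exists m : {set 'I_s} -> R, forall u, 0 < gamma u ->
    'N[cube_measure #|u|]_p[EFin \o mixed_derivative f u]%E = (m u)%:E.
Proof.
move=> Nfin.
exists (fun u => fine 'N[cube_measure #|u|]_p[EFin \o mixed_derivative f u]%E).
move=> u gu; rewrite fineK// ge0_fin_numE ?Lnorm_ge0// ltey.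
by apply/eqP => Nu; apply: Nfin; exists u.
Qed.

Lemma anchored_norm_ge0 (p : \bar R) : (0 <= anchored_norm p gamma f)%E.
Proof.
by rewrite /anchored_norm; case: p => [a| |]; [exact: poweR_ge0|
  exact: bigmax_ge_id|exact: bigmax_ge_id].
Qed.

(** Hoelder's inequality over the components: gamma u is split off so that the
    second factors are the terms of the anchored norm. For p = +oo, when r = 1,
    these are bounded by their maximum. *)
Lemma weighted_sum_le_anchored_norm (p : \bar R) (r : R) (P : pred {set 'I_s})
    (C m : {set 'I_s} -> R) :
  (1 < p)%E -> hoelder_conjugate p = r%:E ->
  (forall u, 0 <= gamma u) -> (forall u, P u -> 0 < gamma u) ->
  (forall u, 0 <= C u) ->
  (forall u, 0 < gamma u ->
    'N[cube_measure #|u|]_p[EFin \o mixed_derivative f u]%E = (m u)%:E) ->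
  ((\sum_(u | P u) (gamma u * C u) * ((gamma u)^-1 * m u))%:E <=
   ((\sum_(u | P u) (gamma u * C u) `^ r) `^ r^-1)%:E *
     anchored_norm p gamma f)%E.
Proof.
move=> p1 rE g0 PU C0 Nm.
have gC0 u : 0 <= gamma u * C u by rewrite mulr_ge0.
have gm0 u : 0 <= (gamma u)^-1 * m u.
  have := g0 u; rewrite le_eqVlt => /predU1P[<-|gu]; first by rewrite invr0 mul0r.
  by rewrite mulr_ge0 ?invr_ge0 ?g0// -lee_fin -Nm// Lnorm_ge0.
case: p p1 rE Nm => [a| |//].
  rewrite lte_fin => a1 rE Nm.
  have a0 : 0 < a by rewrite (lt_trans _ a1).
  have ar := hoelder_conjugate_fineV a1; rewrite rE/= in ar.
  have r0 : 0 < r.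
    rewrite -invr_gt0 -(ltrD2l a^-1) ar addr0 invf_lt1//.
  rewrite (anchored_norm_EFin Nm) -EFinM lee_fin.
  have ra : r^-1 + a^-1 = 1 by rewrite addrC.
  apply: le_trans (hoelder_sum _ _ gC0 gm0 r0 a0 ra) _.
  rewrite ler_wpM2l ?powR_ge0//.
  apply: ge0_ler_powR; rewrite ?invr_ge0 ?nnegrE ?(ltW a0)//.
  - by apply: sumr_ge0 => u _; exact: powR_ge0.
  - by apply: sumr_ge0 => u _; rewrite mulr_ge0 ?powR_ge0.
  rewrite [leLHS]big_mkcond [leRHS]big_mkcond/=.
  apply: ler_sum => u _; case: ifPn => [/PU gu|_].
    rewrite gu powRM ?invr_ge0 ?(ltW gu)//; last first.
      by rewrite -lee_fin -Nm// Lnorm_ge0.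
    by rewrite powRN -powR_inv1 ?(ltW gu)// -[(gamma u `^ a)^-1]powRN -powRrM mulN1r.
  by case: ifP => // _; rewrite mulr_ge0 ?powR_ge0.
rewrite hoelder_conjugatey => _ [<-] Nm.
rewrite invr1 powRr1; last by apply: sumr_ge0 => u _; exact: powR_ge0.
have termX u : P u -> (((gamma u)^-1 * m u)%:E <= anchored_norm +oo gamma f)%E.
  move=> Pu; apply: le_trans (le_bigmax_cond _ _ (PU u Pu)) => /=.
  by rewrite Nm ?PU// EFinM.
have := anchored_norm_ge0 +oo.
case: (anchored_norm +oo gamma f) termX => [X| |//] termX.
  rewrite lee_fin => X0.
  rewrite -EFinM lee_fin big_distrl/=; apply: ler_sum => u Pu.
  by rewrite powRr1// ler_wpM2l// -lee_fin termX.
have [S0|S0] := eqVneq (\sum_(u | P u) (gamma u * C u) `^ 1) 0.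
  move=> _; rewrite S0 mul0e lee_fin.
  have /psumr_eq0P gC : forall u, P u -> 0 <= (gamma u * C u) `^ 1.
    by move=> u _; exact: powR_ge0.
  by rewrite big1// => u Pu; have := gC S0 u Pu; rewrite powRr1// => ->; rewrite mul0r.
move=> _; rewrite gt0_muley ?leey// lte_fin lt_neqAle eq_sym S0/=.
by apply: sumr_ge0 => u _; exact: powR_ge0.
Qed.

End anchored_norm_theory.

(** * The upper bounds for the tail *)

Section upper_bound.
Variables (R : realType) (s : nat) (p q : \bar R) (gamma : {set 'I_s} -> R).
Variables (L : normedModType R) (inj : (s.-tuple R -> R) -> L).
Hypotheses (p1 : (1 <= p)%E) (q1 : (1 <= q)%E).
Hypothesis hL : contains_anchored_space p q gamma inj.
Implicit Types (u w : {set 'I_s}).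

(** It makes partial sums of a decomposition legitimate arguments for the
    linearity of inj. *)
Lemma partial_sum_anchored_space (A : {set {set 'I_s}}) c :
  (forall u, u \in A -> 0 < gamma u /\ F_ p u (c u)) ->
  anchored_space p gamma (fun x => \sum_(u in A) c u x).
Proof.
move=> cA; exists (fun u => if u \in A then c u else fun=> 0); split.
  by move=> u _; case: ifPn => [/cA[]//|_]; exact: F_0.
apply/funext => x; rewrite big_mkcond/= [RHS]big_mkcond/=.
apply: eq_bigr => u _; case: ifPn => [/cA[-> //]|_].
by case: ifP.
Qed.

Lemma inj_zero : inj (fun=> 0) = 0.
Proof.
have sp0 : anchored_space p gamma (fun=> 0).
  exists (fun _ _ => 0); split; first by move=> u _; exact: F_0.
  by apply/funext => x; rewrite big1.
have [/(_ 1 _ _ sp0 sp0) + _ _] := hL.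
rewrite (_ : (fun x => 1 * 0 + 0) = (fun=> 0)); last first.
  by apply/funext => x; rewrite mulr0 addr0.
by rewrite scale1r => /eqP; rewrite -subr_eq0 opprD addrA subrr add0r oppr_eq0 =>
  /eqP.
Qed.

(** inj is linear on the anchored space only. Removing the components one at a
    time keeps all the sums in that space. *)
Lemma ler_norm_inj_sum (A : {set {set 'I_s}}) c :
  (forall u, u \in A -> 0 < gamma u /\ F_ p u (c u)) ->
  `|inj (fun x => \sum_(u in A) c u x)| <= \sum_(u in A) `|inj (c u)|.
Proof.
have [n] := ubnP #|A|; elim: n A => // n IH A An cA.
have [->|[u uA]] := set_0Vmem A.
  rewrite (_ : (fun x => _) = (fun=> 0)); last first.
    by apply/funext => x; rewrite big_set0.
  by rewrite big_set0 inj_zero normr0.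
have cAu v : v \in A :\ u -> 0 < gamma v /\ F_ p v (c v).
  by rewrite in_setD1 => /andP[_ /cA].
have IHu : `|inj (fun x => \sum_(v in A :\ u) c v x)| <=
    \sum_(v in A :\ u) `|inj (c v)|.
  by apply: IH => //; move: An; rewrite (cardsD1 u A) uA.
rewrite (big_setD1 u)//=; apply: le_trans (lerD (lexx _) IHu).
have spu : anchored_space p gamma (c u).
  have := @partial_sum_anchored_space [set u] c.
  rewrite (_ : (fun x => _) = c u); last first.
    by apply/funext => x; rewrite big_set1.
  by apply => v; rewrite inE => /eqP ->; exact: cA.
have [/(_ 1 _ _ spu (partial_sum_anchored_space cAu)) injD _ _] := hL.
have -> : (fun x => \sum_(v in A) c v x) =
    (fun x => 1 * c u x + \sum_(v in A :\ u) c v x).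
  by apply/funext => x; rewrite mul1r (big_setD1 u).
by rewrite injD scale1r ler_normD.
Qed.

Variables (f : s.-tuple R -> R) (c : {set 'I_s} -> s.-tuple R -> R) (k : nat).
Hypothesis fc : anchored_decomposition p gamma f c.
Let T := truncation_tail gamma c k.
Let P u := (0 < gamma u) && ~~ (u \subset first_coords k).
Let N u := 'N[cube_measure #|u|]_p[EFin \o mixed_derivative T u]%E.

Lemma ler_norm_inj_tail : `|inj T| <= \sum_(u | P u) `|inj (c u)|.
Proof.
have [cF _] := fc.
have := @ler_norm_inj_sum [set u | P u] c.
rewrite (eq_bigl P); last by move=> u; rewrite inE.
rewrite (_ : (fun x => _) = T).
  by apply => u; rewrite inE => /andP[gu _]; split => //; exact: cF.
by apply/funext => x; apply: eq_bigl => u; rewrite inE.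
Qed.

(** As c u is the primitive of the derivative that enters the anchored norm, its
    norm in L is that of this primitive, to which the L_q estimates apply. *)
Lemma norm_inj_term u : P u ->
  `|inj (c u)|%:E = 'N[cube_measure #|u|]_q[EFin \o
    (fun y => box_primitive (mixed_derivative T u) (embed y))]%E.
Proof.
move=> /andP[gu uk]; have [_ _ norm_inj] := hL; have [cF _] := fc.
rewrite (norm_inj u)//; last exact: cF.
by have [_ /(_ gu uk) {1}->] := mixed_derivative_tail k u p1 fc.
Qed.

Lemma mixed_derivative_Lfun1 u :
  mixed_derivative T u \in Lfun (cube_measure #|u|) 1%E.
Proof. by have [[]] := mixed_derivative_tail k u p1 fc. Qed.

Lemma norm_inj_term_le (m : R) u : (1 < p)%E -> P u -> N u = m%:E ->
  `|inj (c u)| <= m *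
    anchored_const q (fine (hoelder_conjugate p)) #|u| `^
      (- (fine (hoelder_conjugate p))^-1).
Proof.
move=> p1' Pu Nm; rewrite -lee_fin norm_inj_term//.
have [r' rE r0] := hoelder_conjugate_fine p1'.
have m0 : 0 <= m by rewrite -lee_fin -Nm Lnorm_ge0.
apply: Lnorm_le_anchored_const => //; first by rewrite rE.
- move=> y yc; rewrite box_primitive_embed//.
  exact: normr_box_integral (mixed_derivative_Lfun1 u) yc Nm.
- exact: box_primitive_embed_out.
Qed.

Lemma norm_inj_term_le1 (m : R) u : p = 1%E -> P u -> N u = m%:E ->
  `|inj (c u)| <= m.
Proof.
move=> pE Pu Nm; rewrite -lee_fin norm_inj_term//.
have m0 : 0 <= m by rewrite -lee_fin -Nm Lnorm_ge0.
apply: Lnorm_le_bound => // y.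
have [yc|yc] := pselect (unit_cube #|u| y); last first.
  by rewrite box_primitive_embed_out ?normr0.
rewrite box_primitive_embed// -lee_fin -Nm /N pE.
exact: normr_box_integral1 (mixed_derivative_Lfun1 u).
Qed.

(** The supremum of c u is at most the L_1 norm of its density, and
    gamma u <= eps lets the factor eps / gamma u >= 1 be inserted. *)
Lemma tail_norm_le_eps1 (eps : R) : 0 < eps -> p = 1%E ->
  (forall u, ~~ (u \subset first_coords k) -> gamma u <= eps) ->
  (`|inj T|%:E <= eps%:E * anchored_norm p gamma T)%E.
Proof.
move=> eps0 pE geps.
have [[u gu Nu]|Nfin] := pselect (exists2 u, 0 < gamma u & N u = +oo%E).
  by rewrite (anchored_norm_eqy p1 gu Nu) gt0_muley ?lte_fin// leey.
have [m Nm] := Lnorm_fin_family Nfin.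
have m0 u : 0 < gamma u -> 0 <= m u.
  by move=> gu; rewrite -lee_fin -Nm// Lnorm_ge0.
rewrite [in anchored_norm _]pE (@anchored_norm_EFin _ _ _ _ 1 m); last first.
  by rewrite -[1%:E]pE.
rewrite invr1 powRr1; last first.
  by apply: sumr_ge0 => u _; rewrite mulr_ge0 ?powR_ge0.
rewrite -EFinM lee_fin; apply: le_trans ler_norm_inj_tail _.
rewrite big_distrr/= [leRHS](bigID (fun u => u \subset first_coords k))/=.
rewrite -[leLHS]add0r lerD//.
  by apply: sumr_ge0 => u _; rewrite !mulr_ge0 ?powR_ge0// ltW.
apply: ler_sum => u /andP[gu uk].
rewrite powRr1 ?m0// powR_inv1 ?(ltW gu)// mulrA.
have Pu : P u by rewrite /P gu uk.
apply: le_trans (norm_inj_term_le1 pE Pu (Nm u gu)) _.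
by rewrite ler_peMl ?m0// ler_pdivlMr// mul1r geps.
Qed.

(** The component c u contributes at most C u times the L_p norm of its density,
    where C u bounds the embedding of F_u into L_q; the r-th powers of the
    gamma u * C u are the terms of truncation_bound. *)
Lemma tail_norm_le_eps (eps : R) : 0 < eps -> (1 < p)%E ->
  (forall u, 0 <= gamma u) ->
  truncation_bound p q gamma k <= eps ->
  (`|inj T|%:E <= eps%:E * anchored_norm p gamma T)%E.
Proof.
move=> eps0 p1' g0 Beps.
have [[u gu Nu]|Nfin] := pselect (exists2 u, 0 < gamma u & N u = +oo%E).
  by rewrite (anchored_norm_eqy p1 gu Nu) gt0_muley ?lte_fin// leey.
have [m Nm] := Lnorm_fin_family Nfin.
have m0 u : 0 < gamma u -> 0 <= m u.
  by move=> gu; rewrite -lee_fin -Nm// Lnorm_ge0.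
have [r rE r0] := hoelder_conjugate_fine p1'.
pose C u := anchored_const q r #|u| `^ (- r^-1).
have C0 u : 0 <= C u by exact: powR_ge0.
have tailC : `|inj T| <= \sum_(u | P u) (gamma u * C u) * ((gamma u)^-1 * m u).
  apply: le_trans ler_norm_inj_tail _; apply: ler_sum => u Pu.
  have /andP[gu _] := Pu.
  apply: le_trans (norm_inj_term_le p1' Pu (Nm u gu)) _.
  rewrite rE/= -/(C u) mulrACA mulfV ?gt_eqF// mul1r mulrC.
  exact: lexx.
have boundC : (\sum_(u | P u) (gamma u * C u) `^ r) `^ r^-1 <= eps.
  apply: le_trans Beps; rewrite /truncation_bound rE/=.
  apply: ge0_ler_powR; rewrite ?invr_ge0 ?nnegrE ?(ltW r0)//.
  - by apply: sumr_ge0 => u _; exact: powR_ge0.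
  - by apply: sumr_ge0 => u _; rewrite divr_ge0 ?powR_ge0// ltW// anchored_const_gt0.
  rewrite [leRHS](bigID (fun u => 0 < gamma u))/=.
  rewrite -[leLHS]addr0 lerD//; last first.
    by apply: sumr_ge0 => u _; rewrite divr_ge0 ?powR_ge0// ltW// anchored_const_gt0.
  rewrite le_eqVlt; apply/orP; left; apply/eqP.
  apply: eq_big => [u|u _]; first by rewrite /P andbC.
  rewrite powRM// /C -powRrM mulNr mulVf ?gt_eqF// powR_inv1//.
  by rewrite ltW// anchored_const_gt0.
have subP u : P u -> 0 < gamma u by case/andP.
rewrite -lee_fin in tailC; apply: le_trans tailC _.
apply: le_trans (weighted_sum_le_anchored_norm p1' rE g0 subP C0 Nm) _.
by rewrite lee_wpmul2r ?anchored_norm_ge0// lee_fin.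
Qed.

End upper_bound.

(** * Functions with density concentrated at the origin *)

Lemma bernoulli_ineq (R : realDomainType) (x : R) n : 0 <= x <= 1 ->
  1 - n%:R * x <= (1 - x) ^+ n.
Proof.
move=> /andP[x0 x1]; elim: n => [|n IH]; first by rewrite mul0r subr0 expr0.
rewrite exprS; apply: le_trans (_ : (1 - x) * (1 - n%:R * x) <= _); last first.
  by rewrite ler_wpM2l// subr_ge0.
rewrite mulrBl mul1r mulrBr mulr1 -natr1 mulrDl mul1r !opprD !opprK.
by rewrite !addrA lerDl mulr_ge0// mulr_ge0.
Qed.

Section ramp.
Variables (R : realType) (delta : R).
Hypotheses (delta0 : 0 < delta) (delta1 : delta < 1).

(** For small delta a steep rise from 0 to 1 on [0, delta], constant
    afterwards. *)
Definition ramp (x : R) : R := Num.min (x / delta) 1.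
(** Negative arguments carry no mass; keeping the value delta^-1 there makes
    ramp' the derivative of ramp everywhere except at delta. *)
Definition ramp' (x : R) : R := if x < delta then delta^-1 else 0.

Lemma ramp_lipschitz a b : a <= b -> `|ramp b - ramp a| <= (b - a) / delta.
Proof.
move=> ab; have abd : a / delta <= b / delta.
  by rewrite ler_pM2r ?invr_gt0.
have ramp_le : ramp a <= ramp b by rewrite /ramp le_min2.
rewrite ger0_norm ?subr_ge0// mulrBl.
rewrite /ramp; case: (leP (a / delta) 1) => ad.
  by rewrite lerB// ge_min lexx.
apply: (@le_trans _ _ 0); last by rewrite subr_ge0.
by rewrite subr_le0 ge_min lexx orbT.
Qed.

Lemma abs_cont01_ramp : abs_cont01 ramp.
Proof.
move=> e e0; exists (e * delta); first by rewrite mulr_gt0.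
move=> n a b ab _ sumab.
apply: (@le_lt_trans _ _ (\sum_(i < n) (b i - a i) / delta)).
  by apply: ler_sum => i _; apply: ramp_lipschitz; have [] := ab i.
by rewrite -mulr_suml ltr_pdivrMr.
Qed.

Lemma ramp0 : ramp 0 = 0.
Proof. by rewrite /ramp mul0r; apply/min_idPl; exact: ler01. Qed.

Lemma is_derive_ramp (t : R) : t != delta ->
  is_derive (t : R^o) 1 (ramp : R^o -> R^o) (ramp' t).
Proof.
move=> td; rewrite /ramp'; case: ltP => [tlt|tge].
  apply: (@near_eq_is_derive _ _ _ (fun x : R^o => delta^-1 *: x)).
    near=> x; rewrite /ramp; apply/esym; rewrite /GRing.scale/= mulrC.
    apply/min_idPl; rewrite ler_pdivrMl// mulr1 ltW//.
    by near: x; exact: lt_nbhsl.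
  have := @is_deriveZ R R^o R^o id delta^-1 t 1 1 (is_derive_id _ _).
  by rewrite /GRing.scale/= mulr1.
apply: (@near_eq_is_derive R R^o R^o (cst 1)).
have {tge}td' : delta < t by rewrite lt_neqAle eq_sym td.
near=> x; rewrite /ramp; apply/esym/min_idPr.
rewrite ler_pdivlMr// mul1r ltW//.
by near: x; exact: lt_nbhsr.
Unshelve. all: by end_near. Qed.

Lemma measurable_ramp' : measurable_fun setT (ramp' : measurableTypeR R -> R).
Proof.
apply: measurable_fun_if => //.
- exact: measurable_fun_ltr.
Qed.

Lemma unit_interval_measure_set1 (x : R) : unit_interval_measure [set x] = 0%E.
Proof.
apply/eqP; rewrite -measure_le0.
apply: (@le_trans _ _ (lebesgue_measure [set x])).
  apply: le_measure; rewrite ?inE; [exact: measurableI|exact: measurable_set1|].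
  exact: subIsetl.
by rewrite lebesgue_measure_set1.
Qed.

Lemma in_F_ramp : in_F 1%E ramp ramp'.
Proof.
split.
- exact: abs_cont01_ramp.
- exact: ramp0.
- apply: (@Lfun_subset _ _ _ _ 1%E +oo%E); rewrite ?leey//.
    by rewrite (_ : _ [set: _] = 1%E)//; exact: probability_setT.
  rewrite inE/=; apply/andP; split; rewrite inE/=; first exact: measurable_ramp'.
  apply: le_lt_trans (ltry delta^-1).
  apply: Lnorm_le_bound; [exact: leey|by rewrite invr_ge0 ltW|].
  move=> x; rewrite /ramp'; case: ifP => _.
    by rewrite ger0_norm// invr_ge0 ltW.
  by rewrite normr0 invr_ge0 ltW.
- exists [set delta]; split => //.
  + exact: unit_interval_measure_set1.
  + move=> t /= nt; apply: contrapT => td; apply: nt.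
    by apply: is_derive_ramp; apply/eqP.
Qed.

(** A density of total mass 1 concentrated near the corner 0 of the cube. As
    delta tends to 0, it approximates a unit mass at 0, for which the embedding
    of F_u into L_q would attain its norm 1. *)
Definition corner_density n (t : n.-tuple R) : R := \prod_(i < n) ramp' (tnth t i).

Lemma corner_density_ge0 n (t : n.-tuple R) : 0 <= corner_density t.
Proof.
by apply: prodr_ge0 => i _; rewrite /ramp'; case: ifP => // _; rewrite invr_ge0 ltW.
Qed.

Lemma measurable_corner_density n : measurable_fun setT (@corner_density n).
Proof.
apply: (@measurable_prod_tnth R n (fun=> ramp')) => _; exact: measurable_ramp'.
Qed.

(** The set B allows integration over intervals [0, y) with y >= delta as well
    as over the whole line: all of them catch the whole mass. *)
Lemma integral_ramp' (B : set (measurableTypeR R)) : measurable B ->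
  `[0%R, delta[ `<=` B ->
  (\int[unit_interval_measure]_x (\1_B x * ramp' x)%:E = 1)%E.
Proof.
move=> mB dB.
have ramp'_ge0 x : 0 <= ramp' x.
  by rewrite /ramp'; case: ifP => // _; rewrite invr_ge0 ltW.
have mI : measurable (`[0%R, delta[ : set (measurableTypeR R)).
  exact: measurable_itv.
have d0 : 0 <= delta^-1 by rewrite invr_ge0 ltW.
rewrite integral_unit_interval; last 2 first.
- by apply: measurable_funM; [exact: measurable_indic|exact: measurable_ramp'].
- by move=> x; rewrite mulr_ge0// indicE; case: (_ \in _).
transitivity (\int[lebesgue_measure]_(x in `[0%R, 1%R])
    (delta^-1 * \1_(`[0%R, delta[ : set (measurableTypeR R)) x)%:E)%E.
  apply: eq_integral => x; rewrite inE/= in_itv/= => /andP[x0 x1].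
  rewrite /ramp' !indicE; congr EFin; case: ifPn => xd.
    have xI : `[0%R, delta[%classic x by rewrite /= in_itv/= x0 xd.
    by rewrite !mem_set// ?mul1r ?mulr1//; exact: dB.
  by rewrite [_ \in `[0%R, delta[%classic]memNset ?mulr0//= in_itv/= x0 (negbTE xd).
rewrite -integral_unit_interval; last 2 first.
- by apply: measurable_funM => //; exact: measurable_indic.
- by move=> x; rewrite mulr_ge0// indicE; case: (_ \in _).
under eq_integral do rewrite EFinM.
rewrite ge0_integralZl//; last first.
  by apply/measurable_EFinP; exact: measurable_indic.
rewrite integral_indic// setIT.
rewrite [X in (_ * X)%E](@unit_interval_measure_itv R true true 0 delta)//; last 2 first.
- exact: ltW.
- exact: ltW.
by rewrite subr0 -EFinM mulVf// gt_eqF.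
Qed.

Lemma integral_corner_density n (B : 'I_n -> set (measurableTypeR R)) :
  (forall i, measurable (B i)) -> (forall i, `[0%R, delta[ `<=` B i) ->
  (\int[cube_measure n]_t (\prod_(i < n) (\1_(B i) (tnth t i) * ramp' (tnth t i)))%:E
   = 1)%E.
Proof.
move=> mB dB.
rewrite (@integral_cube_prod R n (fun i x => \1_(B i) x * ramp' x) (fun=> 1)).
- by rewrite big1.
- by move=> i; apply: measurable_funM;
    [exact: measurable_indic|exact: measurable_ramp'].
- move=> i x; rewrite indicE /ramp' mulr_ge0//.
  by case: ifP => // _; rewrite invr_ge0 ltW.
- by move=> i; exact: integral_ramp'.
Qed.

Lemma Lnorm1_corner_density n : 'N[cube_measure n]_1[EFin \o @corner_density n]%E = 1%E.
Proof.
rewrite Lnorm1 -(@integral_corner_density n (fun=> setT))//.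
apply: eq_integral => t _ /=; rewrite ger0_norm ?corner_density_ge0//; congr EFin.
by apply: eq_bigr => i _; rewrite indicT mul1r.
Qed.

Lemma corner_density_Lfun1 n : @corner_density n \in Lfun (cube_measure n) 1%E.
Proof.
rewrite inE/=; apply/andP; split; rewrite inE/=; first exact: measurable_corner_density.
by rewrite /finite_norm Lnorm1_corner_density ltry.
Qed.

Lemma Rintegral_corner_density n (y : n.-tuple R) : (forall i, delta <= tnth y i) ->
  \int[cube_measure n]_(t in anchored_box y) corner_density t = 1.
Proof.
move=> dy; rewrite /Rintegral integral_mkcond.
rewrite -[RHS]/(fine 1%E); congr fine.
rewrite -(@integral_corner_density n (fun i => `[0%R, tnth y i[%classic)).
- apply: eq_integral => t _; rewrite patchE.
  have [ty|ty] := pselect (anchored_box y t).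
    rewrite mem_set//; congr EFin; apply: eq_bigr => i _.
    by rewrite indicE mem_set ?mul1r//= in_itv/=; exact: ty.
  rewrite memNset//; move/existsNP : ty => [i ti].
  by rewrite (bigD1 i)//= indicE memNset ?mul0r//= in_itv.
- by move=> i; exact: measurable_itv.
- move=> i x /=; rewrite !in_itv/= => /andP[-> xd].
  exact: lt_le_trans (dy i).
Qed.

Lemma F_box_primitive_corner s (u : {set 'I_s}) :
  F_ 1%E u (box_primitive (@corner_density #|u|)).
Proof.
exists (@corner_density #|u|); split=> //; first exact: corner_density_Lfun1.
move=> e e0.
exists ((fun x => \sum_(i < 1) 1 *
    \prod_(j < #|u|) ramp (tnth (restr u x) j)) \_ (unit_cube s)), (@corner_density #|u|).
  exists 1%N, (fun=> 1), (fun _ _ => ramp), (fun _ _ => ramp'); split=> //.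
    by move=> _ _; exact: in_F_ramp.
  by apply/funext => y; rewrite big_ord1 mul1r.
rewrite (_ : EFin \o _ = cst 0%E) ?Lnorm0 ?lte_fin//.
  by apply/funext => y /=; rewrite subrr.
Qed.

(** The primitive of the corner density is 1 on [delta, 1]^u, a set of measure
    (1 - delta)^|u|. For a probability measure the L_q norm of the indicator
    function of a set is at least the measure of the set, for every q. *)
Lemma Lnorm_box_primitive_corner s (u : {set 'I_s}) (q : \bar R) : (1 <= q)%E ->
  (((1 - delta) ^+ #|u|)%:E <=
   'N[cube_measure #|u|]_q[EFin \o
      (fun y => box_primitive (@corner_density #|u|) (embed y))])%E.
Proof.
move=> q1; pose n := #|u|.
pose A := [set y : n.-tuple (measurableTypeR R) |
  forall i, (`[delta, 1%R]%classic : set R) (tnth y i)].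
have mA : measurable A.
  apply: (@measurable_product_set R n (fun=> `[delta, 1%R]%classic)) => i.
  exact: measurable_itv.
have muA : cube_measure n A = ((1 - delta) ^+ n)%:E.
  rewrite (@cube_measure_product_set R n (fun=> `[delta, 1%R]%classic)
    (fun=> 1 - delta)).
  - by rewrite prodr_const card_ord.
  - by move=> i; exact: measurable_itv.
  - by move=> i; apply: (@unit_interval_measure_itv R true false delta 1) => //;
      exact: ltW.
have a0 : 0 < (1 - delta) ^+ n by rewrite exprn_gt0// subr_gt0.
have a1 : (1 - delta) ^+ n <= 1.
  by rewrite exprn_ile1// ?subr_ge0 ?(ltW delta1)// gerBl ltW.
apply: (@le_trans _ _ 'N[cube_measure n]_q[EFin \o (\1_A : n.-tuple R -> R)]%E).
  case: q q1 => [t| |//].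
    rewrite lee_fin => t1; have t0 : 0 < t by rewrite (lt_le_trans _ t1).
    rewrite Lnorm_indic// [X in (X `^ _)%E]muA poweR_EFin lee_fin.
    apply: ger1_powR; first by rewrite a0.
    by rewrite invf_le1.
  move=> _; rewrite Lnorm_pinfty leNgt; apply/negP => lt1.
  have ae1 : \forall y \ae cube_measure n, (`|(\1_A y : R)%:E| < 1)%E.
    have := ess_sup_ge (cube_measure n)
      (abse \o (EFin \o (\1_A : n.-tuple R -> R))).
    case=> N [mN N0 subN]; exists N; split => //.
    move=> y /= ny; apply: subN => /= le1; apply: ny.
    apply: le_lt_trans le1 _; apply: lt_le_trans lt1 _.
    by rewrite lee_fin.
  case: ae1 => N [mN N0 subN].
  have : (cube_measure n A <= cube_measure n N)%E.
    apply: le_measure; rewrite ?inE// => y Ay; apply: subN => /=.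
    by rewrite indicE mem_set// normr1 ltxx.
  rewrite [leRHS]N0 [leLHS]muA lee_fin leNgt.
  by rewrite a0.
apply: le_Lnorm => // y /=; rewrite lee_fin indicE.
have [yA|yA] := boolP (y \in A); last by rewrite normr0.
rewrite inE in yA; have dy i : delta <= tnth y i <= 1.
  by have := yA i; rewrite /= in_itv.
rewrite box_primitive_embed; last first.
  move=> i; have /andP[d1 ->] := dy i.
  by rewrite (le_trans (ltW delta0)).
by rewrite Rintegral_corner_density// => i; have /andP[] := dy i.
Qed.

End ramp.

(** * The lower bound for p = 1 *)

Section lower_bound.
Variables (R : realType) (s : nat).
Implicit Types (u v w : {set 'I_s}).

(** Here the uniqueness of densities is needed: the derivative that was picked
    is almost everywhere equal to the given one, and vanishes almost everywhere
    if w is not the index of a component. *)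
Lemma Lnorm1_mixed_derivative_sum (P : pred {set 'I_s})
    (g : forall u, #|u|.-tuple R -> R) w :
  (forall u, P u -> g u \in Lfun (cube_measure #|u|) 1%E) ->
  let f := fun x => \sum_(u | P u) box_primitive (g u) x in
  'N[cube_measure #|w|]_1[EFin \o mixed_derivative f w]%E =
  if P w then 'N[cube_measure #|w|]_1[EFin \o g w]%E else 0%E.
Proof.
move=> gL f; set D := mixed_derivative f w.
have [[DL Dbox] _] := mixed_derivative_sum w gL; rewrite -/f -/D in DL Dbox.
pose g0 : #|w|.-tuple R -> R := if P w then g w else fun=> 0.
have g0L : g0 \in Lfun (cube_measure #|w|) 1%E.
  rewrite /g0; case: ifPn => [/gL//|_].
  apply/Lfun1_integrable; exact: integrable0.
have iD := (Lfun1_integrable _ _).1 DL.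
have ig0 := (Lfun1_integrable _ _).1 g0L.
have -> : (if P w then 'N[cube_measure #|w|]_1[EFin \o g w]%E else 0%E) =
    'N[cube_measure #|w|]_1[EFin \o g0]%E.
  by rewrite /g0; case: ifP => // _; rewrite [RHS]Lnorm0.
have Dg0 y : unit_cube #|w| y ->
    \int[cube_measure #|w|]_(t in anchored_box y) (D t - g0 t) = 0.
  move=> yc; have yc' := (unit_cube_embed _).2 yc.
  have mB := @measurable_anchored_box R _ y.
  rewrite RintegralB//; last 2 first.
  - exact: integrableS iD.
  - exact: integrableS ig0.
  have := Dbox _ yc'; rewrite restr_embed increment_sum_box_primitive// => <-.
  rewrite /g0; case: ifP => _; first by rewrite box_primitive_embed// subrr.
  by rewrite /Rintegral integral0 subrr.
have /ae_eq0_of_anchored_boxes/(_ Dg0) D0 : (cube_measure #|w|).-integrable setT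
    (EFin \o (fun t => D t - g0 t)).
  exact: (integrableB measurableT iD ig0).
have mD := measurable_int _ iD; have mg0 := measurable_int _ ig0.
rewrite !Lnorm1; apply: ge0_ae_eq_integral => //.
- exact: measurableT_comp.
- exact: measurableT_comp.
case: D0 => N [mN N0 subN]; exists N; split => // t /= nt; apply: subN => /= h.
apply: nt => _; have /eqP := h I.
by rewrite eqe subr_eq0 => /eqP ->.
Qed.

Variables (q : \bar R) (gamma : {set 'I_s} -> R) (L : normedModType R)
  (inj : (s.-tuple R -> R) -> L).
Hypotheses (q1 : (1 <= q)%E) (hL : contains_anchored_space 1%E q gamma inj).

(** The primitive f of the corner density on u is its own tail, and its anchored
    norm is 1 / gamma u. The inequality for f thus says that (1 - delta)^|u| is
    at most eps / gamma u, for every delta in (0, 1), which forces gamma u <= eps. *)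
Lemma weight_le_of_tail_norm_le (eps : R) k u : 0 < eps ->
  (forall f c, anchored_decomposition 1%E gamma f c ->
    (`|inj (truncation_tail gamma c k)|%:E
     <= eps%:E * anchored_norm 1%E gamma (truncation_tail gamma c k))%E) ->
  ~~ (u \subset first_coords k) -> gamma u <= eps.
Proof.
move=> eps0 tail_le uk; rewrite leNgt; apply/negP => eps_lt.
have gu : 0 < gamma u := lt_trans eps0 eps_lt.
pose rho := eps / gamma u.
have rho0 : 0 < rho by rewrite divr_gt0.
have rho1 : rho < 1 by rewrite ltr_pdivrMr// mul1r.
(* By Bernoulli's inequality (1 - delta)^|u| >= 1 - |u| delta > rho. *)
pose delta := (1 - rho) / #|u|.+1%:R.
have delta0 : 0 < delta by rewrite divr_gt0// subr_gt0.
have deltan : #|u|%:R * delta < 1 - rho.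
  rewrite /delta mulrCA gtr_pMr ?subr_gt0// ltr_pdivrMr// mul1r ltr_nat//.
have delta1 : delta < 1.
  rewrite ltr_pdivrMr// mul1r; apply: (@lt_le_trans _ _ 1).
    by rewrite gtrBl.
  by rewrite ler1n.
pose f := box_primitive (corner_density delta (n:=#|u|)) : s.-tuple R -> R.
have Ff : F_ 1%E u f by exact: F_box_primitive_corner.
pose c v : s.-tuple R -> R := if v == u then f else fun=> 0.
have fc : anchored_decomposition 1%E gamma f c.
  split; first by move=> v _; rewrite /c; case: eqP => [->|_]//; exact: F_0.
  apply/funext => x; rewrite (bigD1 u)//= big1 ?addr0 /c ?eqxx// => v /andP[_ vu].
  by rewrite (negbTE vu).
have tailE : truncation_tail gamma c k = f.
  apply/funext => x; rewrite /truncation_tail (bigD1 u) ?gu//= big1 ?addr0 /c ?eqxx//.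
  by move=> v /andP[_ vu]; rewrite (negbTE vu).
have := tail_le f c fc; rewrite tailE.
have -> : anchored_norm 1%E gamma f = ((gamma u)^-1)%:E.
  rewrite (@anchored_norm_EFin _ _ _ _ 1 (fun v => (v == u)%:R)).
    rewrite (bigD1 u)//= eqxx big1; last first.
      by move=> v /andP[_ vu]; rewrite (negbTE vu) powR0// mulr0.
    by rewrite addr0 powR1 mulr1 invr1 powR_inv1 ?(ltW gu)// powRr1// invr_ge0 ltW.
  move=> v gv.
  have fE : f = (fun x =>
      \sum_(w | w == u) box_primitive (corner_density delta (n:=#|w|)) x).
    by apply/funext => x; rewrite big_pred1_eq.
  rewrite fE (@Lnorm1_mixed_derivative_sum (pred1 u)
    (fun w => corner_density delta (n:=#|w|))); last first.
    by move=> w _; exact: corner_density_Lfun1.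
  by rewrite /=; case: eqP => // _; exact: Lnorm1_corner_density.
have [_ _ norm_inj] := hL; rewrite (norm_inj u)// -EFinM -/rho => le_rho.
have := le_trans (Lnorm_box_primitive_corner delta0 delta1 u q1) le_rho.
rewrite lee_fin leNgt => /negP; apply.
apply: lt_le_trans (bernoulli_ineq _ _); last by rewrite !ltW.
by rewrite ltrBrDl -ltrBrDr.
Qed.

End lower_bound.

(** * The truncation dimension *)

Lemma least_le (A B : set nat) : B !=set0 -> B `<=` A -> (least A <= least B)%N.
Proof.
move=> B0 BA; have [Bl _] := leastP B0.
by have [_] := leastP (ex_intro A _ (BA _ Bl)); apply; exact: BA.
Qed.

Lemma subset_first_coords s (u : {set 'I_s}) : u \subset first_coords s.
Proof. by apply/fintype.subsetP => j _; rewrite inE ltn_ord. Qed.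

Theorem theorem1 (R : realType) (s : nat) (p q : \bar R)
    (gamma : {set 'I_s} -> R) (eps : R)
    (L : normedModType R) (inj : (s.-tuple R -> R) -> L)
    (hp : (1 <= p)%E) (hq : (1 <= q)%E)
    (hgamma : forall u, 0 <= gamma u) (heps : 0 < eps)
    (hL : contains_anchored_space p q gamma inj) :
  ((1 < p)%E ->
     (truncation_dim p gamma inj eps
      <= least [set k | (truncation_bound p q gamma k <= eps)%R])%N) /\
  (p = 1%E ->
     truncation_dim p gamma inj eps =
     least [set k | \big[Num.max/0]_(u : {set 'I_s} | ~~ (u \subset first_coords k))
                      gamma u <= eps]).
Proof.
split=> [p1|pE].
  apply: least_le.
    have [r rE r0] := hoelder_conjugate_fine p1.
    (* Every u is contained in [s], so the sum for k = s is empty. *)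
    exists s; rewrite /= /truncation_bound rE/= big_pred0 ?powR0 ?ltW//.
      by rewrite invr_neq0// gt_eqF.
    by move=> u; rewrite subset_first_coords.
  by move=> k Bk f c fc; exact: (tail_norm_le_eps hp hq hL fc heps p1 hgamma Bk).
congr least; apply/seteqP; split => k /=.
  move=> Ak; apply/bigmax_leP; split; first exact: ltW.
  move=> u uk; rewrite pE in hL Ak.
  exact: (weight_le_of_tail_norm_le hq hL heps Ak uk).
move=> /bigmax_leP[_ geps] f c fc.
exact: (tail_norm_le_eps1 hp hq hL fc heps pE geps).
Qed.
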